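(* Let $n\ge 2$ and let $\mathcal{D}_n$ be the arrangement in $\mathbb{R}^n$ with hyperplanes $$x_i+x_j=-2,-1,0,\qquad x_i-x_j=-1,0,1\qquad (1\le i<j\le n).$$ The number of $\mathcal{D}$ equivalence classes on the set of symmetric sketches (orders on the letters of $C(n)$), and hence the number of regions of $\mathcal{D}_n$, is $$2^{n-1}\cdot\frac{(2n-2)!}{(n-1)!}\cdot(3n-2).$$
   Context: A region of an arrangement is a connected component of the complement of the union of its hyperplanes. $[n]=\{1,\dots,n\}$. $\mathcal{D}_n$ is the translate (by $X_i=x_i+\tfrac12$) of the type $D$ Catalan arrangement $X_i\pm X_j=-1,0,1$. Let $C(n)$ be the set of $4n$ formal letters $\alpha_i^{(s)}$ and $\alpha_{-i}^{(-s)}$ with $i\in[n]$, $s\in\{0,1\}$. The letter $\alpha_i^{(s)}$ represents $x_i+s$ and $\alpha_{-i}^{(-s)}$ represents $-x_i-s$. The conjugate of $\alpha_i^{(s)}\in C(n)$ is $\overline{\alpha_i^{(s)}}=\alpha_{-i}^{(-s)}$. A symmetric sketch is a total order on $C(n)$ (written as a word using each letter exactly once) such that, whenever the letters involved belong to $C(n)$: (1) if $\alpha_i^{(s)}$ appears before $\alpha_j^{(t)}$, then $\overline{\alpha_j^{(t)}}$ appears before $\overline{\alpha_i^{(s)}}$; (2) if $\alpha_i^{(s-1)}$ appears before $\alpha_j^{(t-1)}$, then $\alpha_i^{(s)}$ appears before $\alpha_j^{(t)}$; (3) $\alpha_i^{(s-1)}$ appears before $\alpha_i^{(s)}$. The $\alpha$-letters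 are $\alpha_i^{(0)}$ and $\alpha_{-i}^{(-1)}$ for $i\in[n]$; the other letters are $\beta$-letters. A $\mathcal{D}$ move on a symmetric sketch is one of: (i) swapping the $2n$-th and $(2n+1)$-th letters; (ii) swapping the $n$-th and $(n+1)$-th $\alpha$-letters if they are adjacent, along with swapping the $n$-th and $(n+1)$-th $\beta$-letters. Two symmetric sketches are $\mathcal{D}$ equivalent if one can be obtained from the other via a series of $\mathcal{D}$ moves. *)

(* Defs.v *)
From HB Require Import structures.
From mathcomp Require Import all_boot all_order all_fingroup all_algebra.
From mathcomp Require Import all_classical all_reals all_analysis.

Set Implicit Arguments.
Unset Strict Implicit.
Unset Printing Implicit Defensive.

Import Order.TTheory GRing.Theory Num.Theory.
Import numFieldNormedType.Exports.

Local Open Scope classical_set_scope.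
Section Arrangements.
Local Open Scope ring_scope.
Variables (R : realType) (n : nat).

Definition D_arrangement : set (set 'rV[R]_n) :=
  [set H | exists i j : 'I_n, (i < j)%N /\
     ((exists2 c : R, c \in [:: -2; -1; 0] &
         H = [set x : 'rV[R]_n | x 0 i + x 0 j = c]) \/
      (exists2 c : R, c \in [:: -1; 0; 1] &
         H = [set x : 'rV[R]_n | x 0 i - x 0 j = c]))].

Definition arrangement_complement (A : set (set 'rV[R]_n)) : set 'rV[R]_n :=
  ~` \bigcup_(H in A) H.

Definition regions (A : set (set 'rV[R]_n)) : set (set 'rV[R]_n) :=
  [set connected_component (arrangement_complement A) x
     | x in arrangement_complement A].

End Arrangements.
Arguments D_arrangement : clear implicits.

(* With [n] identified with 'I_n, the triple (i, false, s) is the letter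
   alpha_i^(s) and (i, true, s) is the letter alpha_{-i}^(-s). *)
Definition letter (n : nat) : finType := ('I_n * bool * bool)%type.

Section Sketches.
Variable n : nat.
Local Open Scope nat_scope.
Implicit Types (a b c d : letter n) (w : seq (letter n)).

(* The subscript, an element of {-n, .., -1, 1, .., n} encoded as an index
   together with a sign. *)
Definition subscript a : 'I_n * bool := a.1.

Definition superscript a : int :=
  (if a.1.2 then - (a.2 : nat)%:Z else (a.2 : nat)%:Z)%R.

Definition conj_letter a : letter n := (a.1.1, ~~ a.1.2, a.2).

(* [shift_of a b] holds when a = alpha_i^(s-1) and b = alpha_i^(s), for some
   i in {-n, .., -1, 1, .., n}. *)
Definition shift_of : rel (letter n) := fun a b =>
  (subscript b == subscript a) && (superscript b == superscript a + 1)%R.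

(* alpha_i^(0) or alpha_{-i}^(-1), for i in [n] *)
Definition is_alpha : pred (letter n) := fun a =>
  [exists i : 'I_n, (a == (i, false, false)) || (a == (i, true, true))].

Definition is_beta : pred (letter n) := fun a => ~~ is_alpha a.

Definition before w a b : bool := index a w < index b w.

Definition symmetric_sketch w : bool :=
  [&& [forall a, count_mem a w == 1],
      [forall a, forall b,
         before w a b ==> before w (conj_letter b) (conj_letter a)],
      [forall a, forall b, forall a', forall b',
         [&& shift_of a a', shift_of b b' & before w a b] ==> before w a' b']
    & [forall a, forall b, shift_of a b ==> before w a b]].

Definition sketch := {w : (4 * n).-tuple (letter n) | symmetric_sketch w}.

Definition swap a b w : seq (letter n) := map (tperm a b) w.

(* [nth_is w k a] : the k-th letter of w, counting from 1, is a. *)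
Definition nth_is w k a : bool := (0 < k) && (onth w k.-1 == Some a).

Definition D_move1 w w' : bool :=
  [exists a, exists b,
     [&& nth_is w (2 * n) a, nth_is w (2 * n + 1) b & w' == swap a b w]].

Definition D_move2 w w' : bool :=
  let alphas := [seq a <- w | is_alpha a] in
  let betas := [seq a <- w | is_beta a] in
  [exists a, exists b, exists c, exists d,
     [&& nth_is alphas n a, nth_is alphas (n + 1) b,
         nth_is betas n c, nth_is betas (n + 1) d,
         index b w == (index a w).+1
       & w' == swap a b (swap c d w)]].

Definition D_move : rel sketch := fun u v =>
  D_move1 (val u) (val v) || D_move2 (val u) (val v).

(* Moves undo themselves, so this reflexive transitive closure is already
   symmetric. *)
Definition D_equivalent : rel sketch := connect D_move.

Definition D_classes : {set {set sketch}} :=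
  equivalence_partition D_equivalent [set: sketch].

End Sketches.

(* Main.v *)
(* By (2), the beta-letters of a symmetric sketch come in the same order as the
   alpha-letters; by (3) the pattern of alphas (ups) and betas (downs) is a
   ballot word; by (1) the order of the alphas and the pattern are both
   mirror-symmetric. A sketch is thus a signed permutation of [n] (the first n
   alphas) together with a ballot word of length 2n (the first half of the
   pattern). Move (i) changes the last letter of the ballot word, move (ii)
   changes the sign of the last entry of the permutation and is available when
   the n-th and (n+1)-st ups are adjacent. So a class is a signed permutation
   together with a ballot word q of length 2n-1, where the last sign is
   forgotten when the n-th and (n+1)-st ups of q followed by an up are adjacent.
   There are 'C(2n-1, n) words q, and deleting the n-th up shows that
   'C(2n-2, n-1) of them are of the second kind.

   A region is determined by the comparisons between letters with different
   indices. Every point off the hyperplanes gives such comparisons of some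
   sketch, and every sketch is realized by a point. If two distinct sketches
   agree on these comparisons, then two neighbours of the first which are
   reversed in the second have the same index, and a move of the first one
   exchanges them; hence the two sketches are equivalent. *)

Require Import Defs.
From mathcomp Require Import all_boot all_order all_fingroup all_algebra.
From mathcomp Require Import zify.

Set Implicit Arguments.
Unset Strict Implicit.
Unset Printing Implicit Defensive.

(** * Ballot words *)

Section Words.
Implicit Types (p q : seq bool) (h k m : nat).

Fixpoint words m : seq (seq bool) :=
  if m is m'.+1 then [seq b :: p | b <- [:: true; false], p <- words m']
  else [:: [::]].

Lemma mem_words m p : (p \in words m) = (size p == m).
Proof.
elim: m p => [|m IH] p; first by case: p.
apply/allpairsP/eqP => [[[b q] /= [_ qm ->]]|].
  by rewrite /=; move: qm; rewrite IH => /eqP ->.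
case: p => // b p [/eqP pm]; exists (b, p); split => //=; last by rewrite IH.
by case: b.
Qed.

Lemma words_uniq m : uniq (words m).
Proof.
elim: m => // m IH; apply: allpairs_uniq => //.
by move=> [b p] [b' p'] _ _ [-> ->].
Qed.

Lemma size_words m : size (words m) = 2 ^ m.
Proof. by elim: m => // m IH; rewrite size_allpairs IH expnS. Qed.

Lemma count_wordsS (P : pred (seq bool)) m :
  count P (words m.+1) =
  count (fun p => P (true :: p)) (words m) +
  count (fun p => P (false :: p)) (words m).
Proof. by rewrite /= cats0 count_cat !count_map. Qed.

(** Lattice paths: [true] is an up-step, [false] a down-step, and the path started at height [h]
    never goes below 0. A variable starting height permits recursion on the first letter. *)
Definition ballot_from h p : bool :=
  all (fun j => count negb (take j p) <= h + count id (take j p))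
      (iota 0 (size p).+1).

Definition ballot p := ballot_from 0 p.

Lemma ballot_fromP h p :
  reflect (forall j, count negb (take j p) <= h + count id (take j p))
          (ballot_from h p).
Proof.
apply: (iffP allP) => [bp j|bp j _] //.
have [jp|pj] := leqP j (size p); first by apply: bp; rewrite mem_iota.
have := bp (size p); rewrite mem_iota leq0n add0n ltnSn take_size => /(_ isT).
by rewrite take_oversize // ltnW.
Qed.

Lemma ballot_from_cons h b p :
  ballot_from h (b :: p) =
  if b then ballot_from h.+1 p else (0 < h) && ballot_from h.-1 p.
Proof.
apply/ballot_fromP/idP => [bp|].
  case: b bp => bp.
    by apply/ballot_fromP => j; have := bp j.+1; rewrite /=; lia.
  have h0 : 0 < h by have := bp 1; rewrite /= take0 /=; lia.
  by rewrite h0; apply/ballot_fromP => j; have := bp j.+1; rewrite /=; lia.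
case: b => [/ballot_fromP bp|/andP[h0 /ballot_fromP bp]] [|j] //=;
  have := bp j; lia.
Qed.

(* The number of ballot words from height [h] telescopes over [h]: the difference
   of consecutive terms satisfies Pascal's rule. *)
Lemma count_ballot_from m h :
  count (ballot_from 0) (words m) = 'C(m, uphalf m) /\
  count (ballot_from h.+1) (words m) =
    count (ballot_from h) (words m) + 'C(m, uphalf (m + h.+1)).
Proof.
(* Split by the first letter: an up leads to height [k + 1], a down to [k - 1], and a down is
   forbidden at height 0. *)
have step k m' : count (ballot_from k) (words m'.+1) =
    count (ballot_from k.+1) (words m') +
    (if k is k'.+1 then count (ballot_from k') (words m') else 0).
  rewrite count_wordsS; congr (_ + _).
    by apply: eq_count => p; rewrite ballot_from_cons.
  under eq_count => p do rewrite ballot_from_cons.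
  by case: k => [|k] /=; [rewrite count_pred0|].
elim: m h => [|m IH] h; first by [].
have IH0 := (IH 0).1; have IHS k := (IH k).2.
split.
  rewrite step IHS IH0 addn0 addn1.
  have [k [-> | ->]] : exists k, m = k.*2 \/ m = k.*2.+1.
    by exists m./2; rewrite -{1 3}(odd_double_half m); case: (odd m); [right|left].
  - have -> : uphalf k.*2 = k by lia.
    have -> : uphalf k.*2.+1 = k.+1 by lia.
    by rewrite binS addnC.
  - have -> : uphalf k.*2.+1 = k.+1 by lia.
    have -> : uphalf k.*2.+2 = k.+1 by lia.
    (* For odd length [2k + 1] the two central binomial coefficients are equal. *)
    rewrite [RHS]binS; congr (_ + _).
    have := @bin_sub k.*2.+1 k.+1.
    have -> : k.*2.+1 - k.+1 = k by lia.
    by move=> -> //; lia.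
case: h => [|h]; rewrite !step !IHS.
  rewrite IH0.
  have -> : uphalf (m + 2) = (uphalf m).+1 by lia.
  have -> : uphalf (m.+1 + 1) = (uphalf m).+1 by lia.
  by rewrite binS; lia.
have -> : uphalf (m + h.+3) = (uphalf (m + h.+1)).+1 by lia.
have -> : uphalf (m.+1 + h.+2) = (uphalf (m + h.+1)).+1 by lia.
by rewrite binS; lia.
Qed.

Lemma count_ballot m : count ballot (words m) = 'C(m, uphalf m).
Proof. exact: (count_ballot_from m 0).1. Qed.

(* The [k]-th and [k+1]-st letters [true] of [rcons p true] are adjacent. *)
Fixpoint adjacent_ups k p : bool :=
  match p, k with
  | false :: p', _ => adjacent_ups k p'
  | true :: p', 1 => head true p'
  | true :: p', k'.+1 => adjacent_ups k' p'
  | _, _ => false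
  end.

Lemma adjacent_upsP k p : 0 < k ->
  reflect (exists u v, rcons p true = u ++ true :: true :: v /\ count id u = k.-1)
          (adjacent_ups k p).
Proof.
elim: p k => [|b p IH] k k0.
  rewrite /=; apply: ReflectF => -[[|? [|? u]] [v [//]]].
case: b => /=; last first.
  apply: (iffP (IH _ k0)) => [[u [v [-> ku]]]|[[|b u] [v [//]]]].
    by exists (false :: u), v.
  by case=> <- e ku; exists u, v.
case: k k0 => // -[|k] _ /=.
  apply: (iffP idP) => [hp|[u [v [e ku]]]].
    by exists [::]; case: p hp {IH} => [|[] p] // _; [exists [::] | exists (rcons p true)].
  case: u e ku => [|b u] /=; last by case=> <-.
  by case=> e _; case: p e {IH} => [//|b p] /= [->].
apply: (iffP (IH k.+1 isT)) => [[u [v [-> ku]]]|[[|b u] [v [//]]]].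
  by exists (true :: u), v; split=> //=; rewrite ku.
by case=> <- e /= [ku]; exists u, v; split=> //=; lia.
Qed.

(* Inserts a letter [true] before the [k]-th [true] of [rcons p true] and removes
   the last letter; the inverse deletes the [k]-th [true]. *)
Fixpoint double_up k p : seq bool :=
  match p, k with
  | [::], _ => [:: true]
  | false :: p', _ => false :: double_up k p'
  | true :: p', k'.+2 => true :: double_up k'.+1 p'
  | true :: p', _ => true :: true :: p'
  end.

(** In the first case the insertion point is found: the clause [head true v] says that an up follows
    it, where an empty [v] stands for the final [true] of [rcons p true]. In the second case [p] has
    too few ups and the new letter lands at the end. *)
Lemma double_upE k p : 0 < k ->
  (exists u v, [/\ p = u ++ v, double_up k p = u ++ true :: v, count id u = k.-1
    & head true v]) \/ (double_up k p = rcons p true /\ count id p < k.-1).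
Proof.
elim: p k => [|b p IH] k k0.
  case: k k0 => // -[|k] _; last by right.
  by left; exists [::], [::].
case: b => /=.
  case: k k0 => // -[|k] _; first by left; exists [::], (true :: p).
  have [[u [v [-> e cu hv]]]|[e cp]] := IH k.+1 isT.
    by left; exists (true :: u), v; rewrite e; split=> //=; lia.
  by right; rewrite e; split=> //=; lia.
have [[u [v [-> e cu hv]]]|[e cp]] := IH k k0.
  by left; exists (false :: u), v; rewrite e; split.
by right; rewrite e; split=> //=; lia.
Qed.

Lemma size_double_up k p : size (double_up k p) = (size p).+1.
Proof.
by elim: p k => [|[] p IH] k //=; [case: k => [|[|k]] //=|]; rewrite IH.
Qed.

Lemma double_up_inj k m : {in words m &, injective (double_up k)}.
Proof.
move=> p q; rewrite !mem_words => /eqP <- /eqP/esym.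
elim: p q k => [|b p IH] [|c q] // k [e].
case: b; case: c => /=.
- case: k => [|[|k]] //=; try by case=> ->.
  by case=> /IH ->.
- by case: k => [|[|k]].
- by case: k => [|[|k]].
- by case=> /IH ->.
Qed.

Lemma count_ids p : count id p + count negb p = size p.
Proof. exact: count_predC. Qed.

(** Inserting an up never breaks a ballot word. Conversely, a prefix of [p] reaching beyond the
    insertion point has at least [m] ups among at most [2m] letters, so it cannot violate the
    inequality. With fewer than [m] ups in [p], the whole new word of length [2m + 1] violates
    it. *)
Lemma ballot_double_up m p : size p = m.*2 ->
  ballot (double_up m.+1 p) = ballot p && (m <= count id p).
Proof.
move=> sp; have [[u [v [e1 e2 cu hv]]]|[e cp]] := @double_upE m.+1 p isT; last first.
  rewrite e [RHS]andbC leqNgt cp /=.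
  apply/ballot_fromP => /(_ m.*2.+1); rewrite -cats1 take_oversize ?size_cat ?sp ?addn1 //.
  by rewrite !count_cat /=; have := count_ids p; rewrite sp; move: cp => /=; lia.
have cp : m <= count id p by rewrite e1 count_cat cu leq_addr.
rewrite cp andbT e2; apply/ballot_fromP/ballot_fromP => b j; last first.
  have [ju|uj] := leqP j (size u).
    by have := b j; rewrite e1 !takel_cat.
  have := b j.-1; rewrite e1 !take_cat.
  have -> : (j < size u) = false by lia.
  have -> : (j.-1 < size u) = false by lia.
  have -> : j - size u = (j.-1 - size u).+1 by lia.
  by rewrite /= !count_cat /=; lia.
have [ju|uj] := leqP j (size u).
  by have := b j; rewrite e1 !takel_cat.
have cj : m <= count id (take j p).
  rewrite e1 take_cat; have -> : (j < size u) = false by lia.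
  by rewrite count_cat cu leq_addr.
rewrite add0n (leq_trans _ cj) //.
by have := count_ids (take j p); rewrite size_take_min sp; lia.
Qed.

Lemma adjacent_double_up m p : size p = m.*2 -> m <= count id p ->
  adjacent_ups m.+1 (double_up m.+1 p).
Proof.
move=> sp cp; apply/adjacent_upsP => //.
have [[u [v [e1 e2 cu hv]]]|[_ /=]] := @double_upE m.+1 p isT; last by rewrite ltnNge cp.
rewrite e2 rcons_cat; exists u; case: v hv {e1 e2} => [|[] v] //= _.
  by exists [::].
by exists (rcons v true).
Qed.

Lemma adjacent_ups_double k q : 0 < k -> adjacent_ups k q ->
  exists p, q = double_up k p.
Proof.
elim: q k => [|[] q IH] [|k] // _ /=; last first.
  by case/(IH k.+1 isT) => p ->; exists (false :: p).
case: k => [|k]; last by case/(IH k.+1 isT) => p ->; exists (true :: p).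
by case: q {IH} => [|[] q] // _; [exists [::] | exists (true :: q)].
Qed.

(** [double_up m.+1] is a bijection onto these words from the ballot words of length [2m], all of
    which have at least [m] ups. *)
Lemma count_adjacent_ballot m :
  count [pred q | ballot q && adjacent_ups m.+1 q] (words m.*2.+1) = 'C(m.*2, m).
Proof.
have := count_ballot m.*2; have -> : uphalf m.*2 = m by lia.
move=> <-; rewrite -!size_filter -(size_map (double_up m.+1) (filter ballot _)).
apply: perm_size; apply: uniq_perm.
- by rewrite filter_uniq // words_uniq.
- rewrite map_inj_in_uniq ?filter_uniq ?words_uniq // => p q.
  by rewrite !mem_filter => /andP[_ pm] /andP[_]; apply: double_up_inj pm.
have big p : ballot p -> size p = m.*2 -> m <= count id p.
  move=> /ballot_fromP/(_ (size p)); rewrite take_size => bp sp.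
  by have := count_ids p; lia.
move=> q; rewrite mem_filter mem_words /=; apply/andP/mapP.
  case=> /andP[bq aq] /eqP sq.
  have [p e] := adjacent_ups_double (isT : 0 < m.+1) aq.
  have sp : size p = m.*2 by have := size_double_up m.+1 p; rewrite -e sq => -[].
  exists p => //; rewrite mem_filter mem_words sp eqxx andbT.
  by move: bq; rewrite e ballot_double_up // => /andP[].
case=> p; rewrite mem_filter mem_words => /andP[bp /eqP sp] ->.
by rewrite size_double_up sp ballot_double_up // bp big // adjacent_double_up ?big.
Qed.
End Words.

(** * Symmetric sketches as pairs of a signed permutation and a ballot word *)

Section Letters.
Variable n : nat.
Implicit Types (a b c d x y : letter n) (w u v : seq (letter n)).

Definition shift_letter a : letter n := (a.1.1, a.1.2, ~~ a.2).
(* Exchanges alpha_i^(0) and alpha_{-i}^(-1), so that conjugation is the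
   composite of [twin] and [shift_letter]. *)
Definition twin a : letter n := (a.1.1, ~~ a.1.2, ~~ a.2).

Lemma is_alphaE a : is_alpha a = (a.1.2 == a.2).
Proof.
apply/existsP/eqP => [[i /orP[] /eqP ->] //|].
by case: a => [[i e] s] /= ->; exists i; case: s; rewrite eqxx ?orbT.
Qed.

(** The superscripts are 0, 1 for a positive subscript and -1, 0 for a negative one; in both cases
    the smaller one belongs to the alpha. *)
Lemma shift_ofE a b : shift_of a b = is_alpha a && (b == shift_letter a).
Proof.
rewrite is_alphaE /shift_of /subscript /superscript /shift_letter.
case: a b => [[i e] s] [[j f] t] /=; rewrite !xpair_eqE.
by case: (eqVneq j i) => //= _; case: e; case: f; case: s; case: t.
Qed.

Lemma shift_letterK : involutive shift_letter.
Proof. by case=> [[i e] s]; rewrite /shift_letter /= negbK. Qed.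
Lemma twinK : involutive twin.
Proof. by case=> [[i e] s]; rewrite /twin /= !negbK. Qed.
Lemma conj_letterK : involutive (@conj_letter n).
Proof. by case=> [[i e] s]; rewrite /conj_letter /= negbK. Qed.
Lemma shift_twin a : shift_letter (twin a) = conj_letter a.
Proof. by rewrite /shift_letter /conj_letter /twin /= negbK. Qed.
Lemma conj_shift a : conj_letter (shift_letter a) = twin a.
Proof. by []. Qed.
Lemma alpha_shift a : is_alpha (shift_letter a) = ~~ is_alpha a.
Proof. by rewrite !is_alphaE; case: a => [[i []] []]. Qed.
Lemma alpha_conj a : is_alpha (conj_letter a) = ~~ is_alpha a.
Proof. by rewrite !is_alphaE; case: a => [[i []] []]. Qed.
Lemma alpha_twin a : is_alpha (twin a) = is_alpha a.
Proof. by rewrite !is_alphaE; case: a => [[i []] []]. Qed.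

(** The four letters of an index form one orbit of the Klein four-group consisting of the identity,
    [conj_letter], [twin] and [shift_letter]. *)
Lemma same_index a b : a.1.1 = b.1.1 -> a != b ->
  [\/ b = conj_letter a, b = twin a | b = shift_letter a].
Proof.
case: a b => [[i e] s] [[j f] t] /= <- ne.
have [fe|fe] := eqVneq f e; have [ts|ts] := eqVneq t s.
- by rewrite fe ts eqxx in ne.
- by apply: Or33; rewrite fe /shift_letter /=; case: t s ts {ne} => [] [].
- by apply: Or31; rewrite ts /conj_letter /=; case: f e fe {ne} => [] [].
- by apply: Or32; rewrite /twin /=; case: f e fe {ne} => [] []; case: t s ts => [] [].
Qed.

Lemma before_trans w : transitive (before w).
Proof. by move=> b a c; apply: ltn_trans. Qed.

Lemma before_irr w : irreflexive (before w).
Proof. by move=> a; apply: ltnn. Qed.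

Lemma before_neq w a b : a \in w -> a != b -> before w a b = ~~ before w b a.
Proof.
move=> aw; rewrite /before -leqNgt [in RHS]leq_eqVlt; case: (index a w =P _) => //= e.
have bw : b \in w by rewrite -index_mem -e index_mem.
by rewrite -[a](nth_index a aw) e nth_index // eqxx.
Qed.

Lemma sorted_before w : uniq w -> sorted (before w) w.
Proof.
move=> uw; have := iota_ltn_sorted 0 (size w).
suff -> : iota 0 (size w) = map (index^~ w) w by rewrite sorted_map.
case: w uw => // a w uw; apply: (@eq_from_nth _ 0); rewrite ?size_map ?size_iota //.
by move=> i iw; rewrite nth_iota // (nth_map a) // index_uniq.
Qed.

Lemma eq_sorted_before w s t : sorted (before w) s -> sorted (before w) t ->
  s =i t -> s = t.
Proof. exact: (irr_sorted_eq (@before_trans w) (@before_irr w)). Qed.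

Lemma index_rev w a : uniq w -> a \in w ->
  index a (rev w) = size w - (index a w).+1.
Proof.
move=> uw aw; have ia : index a w < size w by rewrite index_mem.
have jw : size w - (index a w).+1 < size w by rewrite ltn_subrL (leq_ltn_trans _ ia).
have {1}<- : nth a (rev w) (size w - (index a w).+1) = a.
  by rewrite nth_rev // -subSn // subSS subKn ?nth_index // ltnW.
by rewrite index_uniq ?rev_uniq // size_rev.
Qed.

Lemma before_rev w a b : uniq w -> a \in w -> b \in w ->
  before (rev w) a b = before w b a.
Proof.
move=> uw aw bw.
have : index a w < size w by rewrite index_mem.
have : index b w < size w by rewrite index_mem.
by rewrite /before !index_rev //; lia.
Qed.

Lemma before_map (f : letter n -> letter n) w a b : injective f ->
  before (map f w) (f a) (f b) = before w a b.
Proof. by move=> fI; rewrite /before !index_map. Qed.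

Lemma before_filter (f : pred (letter n)) w a b : f a -> f b ->
  before (filter f w) a b = before w a b.
Proof.
move=> fa fb; rewrite /before; elim: w => // x w IH /=.
case: ifP => [fx /=|fx]; first by case: eqP => _; case: eqP => _ //; rewrite !ltnS.
have /negPf -> : x != a by apply: contraFneq fx => ->.
by have /negPf -> : x != b by apply: contraFneq fx => ->.
Qed.

Lemma before_take w a b j : before w a b -> b \in take j w -> a \in take j w.
Proof.
rewrite /before => ab bj; have bw := mem_take bj.
have aw : a \in w.
  by rewrite -index_mem; apply: ltn_trans ab _; rewrite index_mem.
by move: bj; rewrite (in_take _ aw) (in_take _ bw); apply: ltn_trans.
Qed.

Lemma before_shift w a b :
  filter (@is_beta n) w = map shift_letter (filter (@is_alpha n) w) ->
  is_alpha a -> is_alpha b ->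
  before w (shift_letter a) (shift_letter b) = before w a b.
Proof.
move=> eB fa fb.
rewrite -(before_filter (f := @is_beta n)) ?/is_beta ?alpha_shift ?fa ?fb //.
by rewrite eB before_map ?before_filter //; exact: can_inj shift_letterK.
Qed.

Lemma filter_take (f : pred (letter n)) w j :
  filter f (take j w) = take (count f (take j w)) (filter f w).
Proof.
by rewrite -{3}(cat_take_drop j w) filter_cat take_size_cat // size_filter.
Qed.

(** The pattern [map f w] tells, place by place, which of the two subsequences supplies the next
    letter. *)
Lemma proj_inj (f : pred (letter n)) w w' : map f w = map f w' ->
  filter f w = filter f w' -> filter (predC f) w = filter (predC f) w' -> w = w'.
Proof.
elim: w w' => [|a w IH] [|b w'] //= [e em].
rewrite -e; case: (f a) => /=.
  by case=> -> ef eb; rewrite (IH w').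
by move=> ef [-> eb]; rewrite (IH w').
Qed.

(** Since the betas are the shifts of the alphas in the same order, condition (3) says that the
    [k]-th beta comes after the [k]-th alpha for every [k], which is the ballot property. *)
Lemma ballot_before w : uniq w -> (forall a, a \in w) ->
  filter (@is_beta n) w = map shift_letter (filter (@is_alpha n) w) ->
  reflect (forall a, is_alpha a -> before w a (shift_letter a))
          (ballot (map (@is_alpha n) w)).
Proof.
move=> uw mw eB; set A := filter (@is_alpha n) w in eB.
have uA : uniq A by rewrite filter_uniq.
have cE j : count negb (take j (map (@is_alpha n) w)) = count (@is_beta n) (take j w).
  by rewrite -map_take count_map.
have cE' j : count id (take j (map (@is_alpha n) w)) = count (@is_alpha n) (take j w).
  by rewrite -map_take count_map.
have takeA j a : is_alpha a -> (a \in take j w) = (index a A < count (@is_alpha n) (take j w)).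
  move=> fa; have -> : (a \in take j w) = (a \in filter (@is_alpha n) (take j w)).
    by rewrite mem_filter fa.
  by rewrite filter_take in_take // mem_filter fa mw.
have takeB j a : is_alpha a ->
    (shift_letter a \in take j w) = (index a A < count (@is_beta n) (take j w)).
  move=> fa; have -> : (shift_letter a \in take j w) =
      (shift_letter a \in filter (@is_beta n) (take j w)).
    by rewrite mem_filter /is_beta alpha_shift negbK fa.
  rewrite filter_take eB -map_take mem_map; last exact: can_inj shift_letterK.
  by rewrite in_take // mem_filter fa mw.
apply: (iffP (ballot_fromP _ _)) => [bw a fa|bw j].
  have := bw (index (shift_letter a) w).+1; rewrite cE cE' => le.
  have : shift_letter a \in take (index (shift_letter a) w).+1 w by rewrite in_take.
  rewrite takeB // => /leq_trans/(_ le); rewrite -takeA // in_take // ltnS leq_eqVlt.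
  case/orP=> [/eqP e|//].
  have := nth_index a (mw a); rewrite e nth_index // => /(congr1 (@is_alpha n)).
  by rewrite alpha_shift; case: is_alpha.
(* Suppose a prefix has [k] alphas and more than [k] betas. The alpha at position [k], counted from
   0, is then outside the prefix while its shift is inside. *)
rewrite cE cE' leqNgt; apply/negP => lt; set k := count (@is_alpha n) _ in lt.
have kA : k < size A.
  rewrite (leq_trans lt) // -(size_map shift_letter) -eB size_filter.
  by rewrite -{2}(cat_take_drop j w) count_cat leq_addr.
have [a0 _] : exists a, a \in A by case: (A) kA => // a ? _; exists a; rewrite mem_head.
set a := nth a0 A k; have /andP[fa _] : is_alpha a && (a \in w).
  by rewrite -mem_filter mem_nth.
have := before_take (bw _ fa) (_ : _ \in take j w).
by rewrite takeA // takeB // index_uniq // lt ltnn => /(_ isT).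
Qed.

(** The conditions on pairs of letters turned into equations between words: the third clause encodes
    (1), the fourth (2), the fifth (3). *)
Definition sketch_spec w :=
  [/\ uniq w, forall a, a \in w, rev (map (@conj_letter n) w) = w,
   filter (@is_beta n) w = map shift_letter (filter (@is_alpha n) w)
   & ballot (map (@is_alpha n) w)].

(** A word without repetitions is the only sorted listing of its letters for its own order. A map
    that preserves or reverses this order therefore yields an equality of words. *)
Lemma sketchP w : reflect (sketch_spec w) (symmetric_sketch w).
Proof.
have [uw|nuw] := boolP (uniq w && [forall a, a \in w]); last first.
  apply: (iffP and4P) => [[/forallP c1 _ _ _]|[uw mw _ _ _]]; last first.
    by move: nuw; rewrite uw; move/forallP; case.
  have ww a : a \in w by rewrite -has_pred1 has_count (eqP (c1 a)).
  case/andP: nuw; split; last exact/forallP.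
  by apply: count_mem_uniq => a; rewrite ww; apply/eqP.
move/andP: uw => [uw /forallP mw].
have sB : sorted (before w) (filter (@is_beta n) w).
  apply: sorted_filter (sorted_before uw); exact: before_trans.
have cI := can_inj conj_letterK; have sI := can_inj shift_letterK.
apply: (iffP and4P) => [[_ /forallP c2 /forallP c3 /forallP c4]|[_ _ cw eB bw]].
  have eB : filter (@is_beta n) w = map shift_letter (filter (@is_alpha n) w).
    apply: eq_sorted_before sB _ _.
      rewrite sorted_map.
      have : sorted (before w) (filter (@is_alpha n) w).
        apply: sorted_filter (sorted_before uw); exact: before_trans.
      apply: (sub_in_sorted _ (filter_all _ _)) => a b fa fb ab.
      have {}fa : is_alpha a := fa; have {}fb : is_alpha b := fb.
      move: (c3 a) => /forallP/(_ b)/forallP/(_ (shift_letter a)).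
      move/forallP/(_ (shift_letter b)); rewrite !shift_ofE fa fb ab !eqxx.
      exact.
    move=> a; rewrite -[a in RHS]shift_letterK mem_map // !mem_filter !mw.
    by rewrite /is_beta alpha_shift.
  split=> //; last first.
    apply/ballot_before => // a fa.
    by have /forallP/(_ (shift_letter a)) := c4 a; rewrite shift_ofE fa eqxx.
  apply: (@eq_sorted_before w); last first.
  - by move=> a; rewrite mem_rev -[a in LHS]conj_letterK mem_map // !mw.
  - exact: sorted_before.
  rewrite rev_sorted sorted_map; apply: sub_sorted (sorted_before uw) => a b ab.
  by have /forallP/(_ b) := c2 a; rewrite ab.
split.
- by apply/forallP => a; rewrite count_uniq_mem // mw.
- apply/forallP => a; apply/forallP => b; apply/implyP => ab.
  by rewrite -cw before_rev ?before_map ?map_inj_uniq //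
    -{1}(conj_letterK a, conj_letterK b) mem_map.
- apply/forallP => a; apply/forallP => b; apply/forallP => a'; apply/forallP => b'.
  apply/implyP; rewrite !shift_ofE => /and3P[/andP[fa /eqP ->] /andP[fb /eqP ->]].
  by rewrite before_shift.
- apply/forallP => a; apply/forallP => b; apply/implyP.
  by rewrite shift_ofE => /andP[fa /eqP ->]; apply: (ballot_before uw mw eB).
Qed.

End Letters.

(** * The two moves *)

Section SketchSymmetry.
Variable n : nat.
Implicit Types (a b c d x y : letter n) (w u v : seq (letter n)).

Definition alphas w := [seq a <- w | is_alpha a].
Definition updown w := map (@is_alpha n) w.

Lemma size_sketch w : sketch_spec w -> size w = 4 * n.
Proof.
case=> /card_uniqP <- mw _ _ _.
have -> : #|w| = #|{: letter n}| by apply: eq_card => a; rewrite mw.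
by rewrite !card_prod card_ord card_bool -mulnA mulnC.
Qed.

Lemma size_alphas w : sketch_spec w -> size (alphas w) = 2 * n.
Proof.
move=> sw; have := size_sketch sw; case: sw => _ _ _ eB _.
have := count_predC (@is_alpha n) w; rewrite -!size_filter -/(alphas w).
have -> : size (filter (predC (@is_alpha n)) w) = size (alphas w).
  by rewrite -(size_map (@shift_letter n) (alphas w)) -eB.
lia.
Qed.

(** Reading backwards, the alphas are the conjugates of the betas, the betas are the shifts of the
    alphas, and conjugation after shifting is [twin]. *)
Lemma alphas_sym w : sketch_spec w -> rev (map (@twin n) (alphas w)) = alphas w.
Proof.
case=> _ _ cw eB _; rewrite -{2}cw [RHS]/alphas filter_rev filter_map.
congr rev; have -> : filter (preim (@conj_letter n) (@is_alpha n)) w = filter (@is_beta n) w.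
  by apply: eq_filter => a /=; rewrite alpha_conj.
by rewrite eB -map_comp; apply: eq_map.
Qed.

Lemma updown_sym w : sketch_spec w -> rev (map negb (updown w)) = updown w.
Proof.
case=> _ _ cw _ _; rewrite -{2}cw /updown map_rev -!map_comp; congr rev.
by apply: eq_map => a /=; rewrite alpha_conj.
Qed.

Lemma half_sym (T : Type) (f : T -> T) s k : rev (map f s) = s -> size s = k + k ->
  s = take k s ++ rev (map f (take k s)).
Proof.
move=> e sk; rewrite -{1}(cat_take_drop k s); congr (_ ++ _).
by rewrite -{1}e drop_rev size_map sk addnK map_take.
Qed.

(** Mirror symmetry recovers the second halves, the alphas determine the betas, and [proj_inj]
    reassembles the word. *)
Lemma sketch_inj w w' : sketch_spec w -> sketch_spec w' ->
  take n (alphas w) = take n (alphas w') ->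
  take (2 * n) (updown w) = take (2 * n) (updown w') -> w = w'.
Proof.
move=> sw sw' eA eP.
have eA' : alphas w = alphas w'.
  rewrite (half_sym (alphas_sym sw) (k := n)) ?size_alphas ?eA //; last lia.
  rewrite -(half_sym (alphas_sym sw') (k := n)) // ?size_alphas //; lia.
apply: (@proj_inj n (@is_alpha n)) => //.
  rewrite -!/(updown _).
  rewrite (half_sym (updown_sym sw) (k := 2 * n)) ?size_map ?size_sketch ?eP //; last lia.
  rewrite -(half_sym (updown_sym sw') (k := 2 * n)) // ?size_map ?size_sketch //; lia.
by case: sw => _ _ _ eB _; case: sw' => _ _ _ eB' _; rewrite [LHS]eB [RHS]eB' -!/(alphas _) eA'.
Qed.

Lemma index_sym (f : letter n -> letter n) w a : injective f ->
  uniq w -> a \in w -> rev (map f w) = w -> index (f a) w = size w - (index a w).+1.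
Proof.
move=> fI uw aw e; rewrite -{1}e index_rev ?map_inj_uniq //; last by rewrite mem_map.
by rewrite size_map index_map.
Qed.

Lemma index_adjacent u v a b : uniq (u ++ a :: b :: v) ->
  index a (u ++ a :: b :: v) = size u /\ index b (u ++ a :: b :: v) = (size u).+1.
Proof.
rewrite cat_uniq /= inE !negb_or.
case/and3P=> _ /and3P[au bu _] /and3P[/andP[ab _] _ _].
rewrite !index_cat (negPf au) (negPf bu) /= !eqxx (negPf ab); lia.
Qed.

Lemma adjacent_split w a b : b \in w -> index b w = (index a w).+1 ->
  exists u v, w = u ++ a :: b :: v /\ size u = index a w.
Proof.
move=> bw e; have ib : index b w < size w by rewrite index_mem.
have ia : index a w < size w by rewrite -e ltnW.
have aw : a \in w by rewrite -index_mem.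
exists (take (index a w) w), (drop (index a w).+2 w).
rewrite size_takel 1?ltnW //; split=> //.
rewrite -{1}(cat_take_drop (index a w) w) (drop_nth a) // nth_index //.
by rewrite (drop_nth a) -e // nth_index.
Qed.

Lemma swap_split u v a b : uniq (u ++ a :: b :: v) ->
  swap a b (u ++ a :: b :: v) = u ++ b :: a :: v.
Proof.
rewrite cat_uniq /= inE !negb_or.
case/and3P=> _ /and3P[au bu _] /and3P[/andP[ab av] bv _].
rewrite /swap map_cat /= tpermL tpermR.
have fix_ t : a \notin t -> b \notin t -> map (tperm a b) t = t.
  move=> at_ bt; rewrite -[RHS]map_id; apply/eq_in_map => x xt.
  by rewrite tpermD //; [apply: contraNneq at_ => -> | apply: contraNneq bt => ->].
by rewrite !fix_.
Qed.

(** After an odd number of steps the height is odd, hence positive, so either step is allowed next;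
    after the pair both paths are at the same height. *)
Lemma ballot_toggle (p r : seq bool) (b : bool) : odd (size p) ->
  ballot (p ++ b :: ~~ b :: r) -> ballot (p ++ ~~ b :: b :: r).
Proof.
move=> op /ballot_fromP bp; apply/ballot_fromP => j.
have := bp j; have [jp|pj] := leqP j (size p); first by rewrite !takel_cat.
have := bp (size p); rewrite take_size_cat // !take_cat ltnNge (ltnW pj) /=.
have -> : j - size p = (j - (size p).+1).+1 by lia.
have := count_ids p; case: (j - (size p).+1) => [|k] /=; rewrite !count_cat /= ?take0 /=; lia.
Qed.

Lemma perm_adjacent u v a b : perm_eq (u ++ a :: b :: v) (u ++ b :: a :: v).
Proof. by rewrite perm_cat2l (perm_catCA [:: a] [:: b] v). Qed.

(** Conjugate letters occupy mirror positions, so conjugate neighbours must be the two middle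
    letters. *)
Lemma middle_conj u v a : sketch_spec (u ++ a :: conj_letter a :: v) ->
  size u = (2 * n).-1 /\ 0 < n.
Proof.
move=> sw; have sz := size_sketch sw; have [uw mw cw _ _] := sw.
have := index_sym (can_inj (@conj_letterK n)) uw (mw a) cw.
have [-> ->] := index_adjacent uw; rewrite sz.
have : 0 < n by rewrite (leq_ltn_trans _ (ltn_ord a.1.1)).
lia.
Qed.

(** Exactly one of two conjugate letters is an alpha, so the exchange alters neither the alphas nor
    the betas. The pattern changes only in its two middle places, and [ballot_toggle] applies since
    [2n - 1] is odd. *)
Lemma sketch_swap_conj u v a : sketch_spec (u ++ a :: conj_letter a :: v) ->
  sketch_spec (u ++ conj_letter a :: a :: v).
Proof.
move=> sw; have [su n0] := middle_conj sw; have sz := size_sketch sw.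
have [uw mw cw eB bw] := sw.
have pw := perm_adjacent u v a (conj_letter a).
have fE (f : pred (letter n)) : f (conj_letter a) = ~~ f a ->
    filter f (u ++ conj_letter a :: a :: v) = filter f (u ++ a :: conj_letter a :: v).
  by move=> fa; rewrite !filter_cat /= fa; case: (f a).
split.
- by rewrite -(perm_uniq pw).
- by move=> x; rewrite -(perm_mem pw).
- move: cw; rewrite !map_cat /= !rev_cat !rev_cons !cat_rcons !conj_letterK /=.
  move/eqP; rewrite eqseq_cat; last first.
    rewrite size_rev size_map su; move: sz; rewrite size_cat /= su; lia.
  by rewrite !eqseq_cons => /and4P[/eqP -> _ _ /eqP ->].
- by rewrite !fE ?/is_beta ?alpha_conj.
- move: bw; rewrite !map_cat /= !alpha_conj => bw.
  by apply: ballot_toggle bw; rewrite size_map su; lia.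
Qed.

(** Move (ii) as a relabelling of letters: it reverses the sign of the index [i]. It commutes with
    shifting and conjugation and keeps alphas alphas, so it carries every sketch to a sketch,
    whether or not the move is available. *)
Definition flip (i : 'I_n) x : letter n := if x.1.1 == i then twin x else x.

Lemma flipK i : involutive (flip i).
Proof.
by move=> x; rewrite /flip; case: (boolP (x.1.1 == i)) => /= [->|/negPf ->] //; rewrite twinK.
Qed.

Lemma alpha_flip i x : is_alpha (flip i x) = is_alpha x.
Proof. by rewrite /flip; case: ifP => //; rewrite alpha_twin. Qed.

Lemma flip_shift i x : flip i (shift_letter x) = shift_letter (flip i x).
Proof. by rewrite /flip /=; case: ifP. Qed.

Lemma flip_conj i x : flip i (conj_letter x) = conj_letter (flip i x).
Proof. by rewrite /flip /=; case: ifP. Qed.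

Lemma filter_flip (f : pred (letter n)) i w : (forall x, f (flip i x) = f x) ->
  filter f (map (flip i) w) = map (flip i) (filter f w).
Proof. by move=> fE; rewrite filter_map; congr map; apply: eq_filter. Qed.

Lemma sketch_flip i w : sketch_spec w -> sketch_spec (map (flip i) w).
Proof.
have fI := can_inj (flipK i); case=> uw mw cw eB bw; split.
- by rewrite map_inj_uniq.
- by move=> x; rewrite -[x](flipK i) mem_map.
- rewrite -{2}cw map_rev -!map_comp; congr rev.
  by apply: eq_map => x /=; rewrite flip_conj.
- rewrite !filter_flip => [|x|x]; rewrite ?/is_beta ?alpha_flip //.
  rewrite eB -!map_comp; by apply: eq_map => x /=; rewrite flip_shift.
- rewrite -map_comp (eq_map (g := @is_alpha n)) // => x /=; exact: alpha_flip.
Qed.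

Lemma flip_tperm a x :
  tperm a (twin a) (tperm (shift_letter a) (shift_letter (twin a)) x) = flip a.1.1 x.
Proof.
have tE (y z t : letter n) : tperm y z t = if t == y then z else if t == z then y else t.
  by case: tpermP => [->|->|/eqP/negPf -> /eqP/negPf ->] //; rewrite eqxx //; case: eqP.
rewrite !tE /flip; case: a x => [[i e] s] [[j f] t] /=.
rewrite /twin /shift_letter /=; have [->|/negPf ne] := eqVneq j i.
  by case: e; case: s; case: f; case: t; rewrite /= !(xpair_eqE, eqxx) /= ?xpair_eqE ?eqxx.
by rewrite !xpair_eqE ne /= !xpair_eqE ne.
Qed.

End SketchSymmetry.

Section Moves.
Variable n : nat.
Implicit Types (a b c d x y : letter n) (w u v : seq (letter n)).

Lemma nth_isP w k a : uniq w ->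
  reflect [/\ 0 < k, a \in w & index a w = k.-1] (nth_is w k a).
Proof.
move=> uw; apply: (iffP andP) => [[k0 /eqP e]|[k0 aw e]].
  have kw : k.-1 < size w by rewrite -onthTE e.
  have na := @onth_nth _ a _ _ _ e; split=> //; first by rewrite -na mem_nth.
  by rewrite -{1}na index_uniq.
split=> //; have := onthTE w k.-1; rewrite -e index_mem aw.
by case E: (onth w _) => [b|//] _; rewrite -(@onth_nth _ a _ _ _ E) nth_index.
Qed.

Lemma index_injl w a b : a \in w -> index a w = index b w -> a = b.
Proof.
move=> aw e; rewrite -[a](nth_index a aw) e nth_index //.
by rewrite -index_mem -e index_mem.
Qed.

(** Positions disappear from move (i): by mirror symmetry the middle letters are conjugate, and by
    [middle_conj] conjugate neighbours are in the middle. *)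
Lemma D_move1P w w' : sketch_spec w ->
  reflect (exists u a v, w = u ++ a :: conj_letter a :: v /\
             w' = u ++ conj_letter a :: a :: v)
          (D_move1 w w').
Proof.
move=> sw; have [uw mw cw _ _] := sw; apply: (iffP existsP).
  case=> a /existsP[b /and3P[]] /nth_isP-/(_ uw)[n0 aw ia] /nth_isP-/(_ uw)[_ bw ib] /eqP ->.
  have eb : b = conj_letter a.
    apply: (@index_injl w) => //.
    by rewrite (index_sym (can_inj (@conj_letterK n)) uw aw cw) (size_sketch sw); lia.
  have [||u [v [ew _]]] := @adjacent_split n w a b => //; first by rewrite ia ib; lia.
  by exists u, a, v; rewrite {2}ew swap_split -?ew // -eb.
case=> u [a [v [ew ->]]]; exists a; apply/existsP; exists (conj_letter a).
rewrite ew in sw uw mw *; have [su n0] := middle_conj sw.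
have [ia ib] := index_adjacent uw.
apply/and3P; split; last by rewrite swap_split.
  by apply/nth_isP => //; split=> //; [lia | rewrite ia].
by apply/nth_isP => //; split=> //; [lia | rewrite ib su; lia].
Qed.

Lemma middle_twin u v a : is_alpha a -> sketch_spec (u ++ a :: twin a :: v) ->
  count (@is_alpha n) u = n.-1 /\ 0 < n.
Proof.
move=> fa sw; set w := _ ++ _ in sw.
have n0 : 0 < n by rewrite (leq_ltn_trans _ (ltn_ord a.1.1)).
have [uw mw _ _ _] := sw; split=> //.
have uA : uniq (alphas w) by rewrite filter_uniq.
have eA : alphas w = alphas u ++ a :: twin a :: alphas v.
  by rewrite /alphas filter_cat /= alpha_twin fa.
have aA : a \in alphas w by rewrite mem_filter fa mw.
have := index_sym (can_inj (@twinK n)) uA aA (alphas_sym sw); rewrite size_alphas //.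
have := index_adjacent (u := alphas u) (a := a) (b := twin a) (v := alphas v).
by rewrite -eA => /(_ uA) [-> ->]; rewrite size_filter; move: (count _ u); lia.
Qed.

(** By [alphas_sym] the two middle alphas are twins, and the two middle betas are their shifts. The
    two exchanges thus act on all four letters of one index, which is a [flip]. *)
Lemma D_move2P w w' : sketch_spec w ->
  reflect (exists u a v, [/\ w = u ++ a :: twin a :: v, is_alpha a &
             w' = map (flip a.1.1) w])
          (D_move2 w w').
Proof.
move=> sw; have [uw mw _ eB _] := sw.
have uA : uniq (alphas w) by rewrite filter_uniq.
have uB : uniq (filter (@is_beta n) w) by rewrite filter_uniq.
have iB a : index (shift_letter a) (filter (@is_beta n) w) = index a (alphas w).
  by rewrite eB index_map //; exact: can_inj (@shift_letterK n).
have fE a : swap a (twin a) (swap (shift_letter a) (shift_letter (twin a)) w) =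
    map (flip a.1.1) w.
  by rewrite /swap -map_comp; apply: eq_map => x; rewrite /= flip_tperm.
rewrite /D_move2 -/(alphas w); apply: (iffP existsP).
  case=> a /existsP[b /existsP[c /existsP[d]]].
  case/and5P=> /nth_isP-/(_ uA)[n0 aA ia] /nth_isP-/(_ uA)[_ bA ib].
  case/nth_isP=> // _ cB ic /nth_isP-/(_ uB)[_ dB id] /andP[/eqP ab /eqP ->].
  have eb : b = twin a.
    apply: (@index_injl (alphas w)) => //.
    by rewrite (index_sym (can_inj (@twinK n)) uA aA (alphas_sym sw)) size_alphas //; lia.
  have ec : c = shift_letter a.
    by apply: (@index_injl (filter (@is_beta n) w)) => //; rewrite ic iB ia.
  have ed : d = shift_letter b.
    by apply: (@index_injl (filter (@is_beta n) w)) => //; rewrite id iB ib.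
  have [||u [v [ew _]]] := @adjacent_split n w a b => //.
  exists u, a, v; split; [by rewrite -eb|by move: aA; rewrite mem_filter => /andP[]|].
  by rewrite ec ed eb fE.
case=> u [a [v [ew fa ->]]].
exists a; apply/existsP; exists (twin a); apply/existsP; exists (shift_letter a).
apply/existsP; exists (shift_letter (twin a)).
have [cu n0] : count (@is_alpha n) u = n.-1 /\ 0 < n.
  by apply: (middle_twin fa (v := v)); rewrite -ew.
have eA : alphas w = alphas u ++ a :: twin a :: alphas v.
  by rewrite ew /alphas filter_cat /= alpha_twin fa.
have [ia ib] : index a (alphas w) = n.-1 /\ index (twin a) (alphas w) = n.
  have := index_adjacent (u := alphas u) (a := a) (b := twin a) (v := alphas v).
  rewrite -eA => /(_ uA) [-> ->]; rewrite size_filter cu; lia.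
apply/and5P; split; last (apply/andP; split); rewrite ?fE //.
- by apply/nth_isP => //; rewrite mem_filter fa mw.
- by apply/nth_isP => //; rewrite mem_filter alpha_twin fa mw; split=> //; lia.
- by apply/nth_isP => //; rewrite iB mem_filter /is_beta alpha_shift fa mw; split.
- apply/nth_isP => //; rewrite iB mem_filter /is_beta alpha_shift alpha_twin fa mw.
  by split=> //; lia.
- by have := uw; rewrite ew => /index_adjacent[-> ->].
Qed.

End Moves.

(** * Invariants of the equivalence classes *)

Section Codes.
Variable n : nat.
Implicit Types (a b c d x y : letter n) (w u v : seq (letter n)) (r s t : sketch n).

Definition first_alphas w := take n (alphas w).
Definition indices w := map (fun a : letter n => a.1.1) (first_alphas w).
Definition signs w := map (fun a : letter n => a.1.2) (first_alphas w).
Definition ups w := take (2 * n).-1 (updown w).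

(* The second component does not depend on the last sign when move (ii) can change it. *)
Definition class_code w :=
  (indices w,
   if adjacent_ups n (ups w) then rcons (take n.-1 (signs w)) false else signs w,
   ups w).

Definition word s : seq (letter n) := val (val s).

Lemma wordP s : sketch_spec (word s).
Proof. exact/sketchP/(valP s). Qed.

Lemma word_inj : injective word.
Proof. by move=> s t e; apply/val_inj/val_inj. Qed.

Lemma sketch_of w : sketch_spec w -> exists s, word s = w.
Proof.
move=> sw; have sz : size w == 4 * n by rewrite size_sketch.
have /sketchP sw' : sketch_spec (Tuple sz) by [].
by exists (exist _ (Tuple sz) sw').
Qed.

Lemma ballot_size w u v : ballot (updown w) -> w = u ++ v ->
  size u <= (count (@is_alpha n) u).*2.
Proof.
move=> + e; rewrite e => /ballot_fromP/(_ (size u)).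
rewrite /updown map_cat take_size_cat ?size_map // !count_map add0n.
by have := count_predC (@is_alpha n) u; rewrite -addnn => <-; rewrite leq_add2l.
Qed.

(** With only [n - 1] ups in [u], the ballot property bounds its length by [2n - 2]. So [a] is among
    the first [2n - 1] letters, and [b] is at worst the [2n]-th letter, which [adjacent_ups] takes
    to be an up. *)
Lemma ups_adjacent u a b v : is_alpha a -> is_alpha b ->
  count (@is_alpha n) u = n.-1 -> 0 < n ->
  ballot (updown (u ++ a :: b :: v)) ->
  adjacent_ups n (ups (u ++ a :: b :: v)).
Proof.
move=> fa fb cu n0 bw; have su := ballot_size bw erefl; rewrite cu in su.
apply/adjacent_upsP => //; exists (updown u).
rewrite /ups /updown map_cat /= fa fb take_cat size_map.
have lu : size u < (2 * n).-1 by rewrite (leq_ltn_trans su) //; lia.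
rewrite ltnNge ltnW //= rcons_cat; move: lu; rewrite -subn_gt0.
case: (_.-1 - size u) => [|[|k]] //= _.
- by exists [::]; rewrite count_map; case: v {bw}.
- by exists (rcons (take k (map (@is_alpha n) v)) true); rewrite count_map.
Qed.

Lemma updown_split w (U V : seq bool) (x y : bool) : updown w = U ++ x :: y :: V ->
  exists u a b v, [/\ w = u ++ a :: b :: v, updown u = U, is_alpha a = x & is_alpha b = y].
Proof.
elim: U w => [|z U IH] [|a w] //=.
  by case: w => // b w [<- <- _]; exists [::], a, b, w.
by case=> <- /IH [u [c [b [v [-> <- <- <-]]]]]; exists (a :: u), c, b, v.
Qed.

Lemma index_twin w a : sketch_spec w -> is_alpha a ->
  index (twin a) (alphas w) = 2 * n - (index a (alphas w)).+1.
Proof.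
move=> sw fa; have [uw mw _ _ _] := sw.
rewrite (index_sym (can_inj (@twinK n))) ?size_alphas ?alphas_sym ?filter_uniq //.
by rewrite mem_filter fa mw.
Qed.

(** Once the [2n]-th letter really is an alpha, adjacency in the truncated pattern is adjacency in
    the sketch, and the two middle alphas are twins. *)
Lemma adjacent_ups_split w : sketch_spec w -> 0 < n ->
  take (2 * n) (updown w) = rcons (ups w) true -> adjacent_ups n (ups w) ->
  exists u a v, [/\ w = u ++ a :: twin a :: v, is_alpha a & count (@is_alpha n) u = n.-1].
Proof.
move=> sw n0 e /adjacent_upsP-/(_ n0)[U [V [eq cU]]].
have := cat_take_drop (2 * n) (updown w); rewrite e eq -catA /=.
move=> /esym/updown_split [u [a [b [v [ew eu fa fb]]]]].
exists u, a, v; have cu : count (@is_alpha n) u = n.-1 by rewrite -cU -eu count_map.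
split=> //; rewrite ew; congr (_ ++ _ :: _ :: _).
have [uw mw _ _ _] := sw.
have eA : alphas w = alphas u ++ a :: b :: alphas v by rewrite ew /alphas filter_cat /= fa fb.
apply: (@index_injl _ (alphas w)); first by rewrite mem_filter fb mw.
rewrite index_twin //.
have := index_adjacent (u := alphas u) (a := a) (b := b) (v := alphas v).
rewrite -eA filter_uniq // => /(_ isT) [-> ->]; rewrite size_filter cu; lia.
Qed.

Lemma D_move_code s t : D_move s t -> class_code (word s) = class_code (word t).
Proof.
have sw := wordP s; case/orP.
  case/(D_move1P _ sw) => u [a [v [es et]]].
  have eA : alphas (word s) = alphas (word t).
    by rewrite es [word t]et /alphas !filter_cat /= alpha_conj; case: is_alpha.
  rewrite es in sw; have [su n0] := middle_conj sw.
  have eu : ups (word s) = ups (word t).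
    by rewrite es [word t]et /ups /updown !map_cat !take_size_cat // size_map su.
  by rewrite /class_code /indices /signs /first_alphas eA eu.
case/(D_move2P _ sw) => u [a [v [es fa et]]].
rewrite -/(word s) in es; rewrite -/(word s) -/(word t) in et.
have eu : ups (word t) = ups (word s).
  rewrite et /ups /updown -map_comp; congr take; apply: eq_map => x /=.
  exact: alpha_flip.
have [cu n0] : count (@is_alpha n) u = n.-1 /\ 0 < n.
  by apply: (middle_twin fa (v := v)); rewrite -es.
have ad : adjacent_ups n (ups (word s)).
  rewrite es; apply: ups_adjacent; rewrite ?alpha_twin // -es.
  by case: sw.
have eA : alphas (word t) = map (flip a.1.1) (alphas (word s)).
  by rewrite et /alphas filter_flip //; exact: alpha_flip.
rewrite /class_code eu ad; congr (_, rcons _ _, _).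
  rewrite /indices /first_alphas eA -map_take -map_comp; apply: eq_map => x /=.
  by rewrite /flip; case: ifP.
rewrite /signs /first_alphas eA -!map_take -map_comp; apply/eq_in_map => x xA /=.
(* None of the first [n - 1] alphas has the index of [a]: the only alphas with that index are [a]
   and [twin a], in places [n] and [n + 1]. *)
rewrite /flip ifN //; apply/negP => /eqP ex.
have [uw mw _ _ _] := sw.
have uA : uniq (alphas (word s)) by rewrite filter_uniq.
have fx : is_alpha x by move: (mem_take (mem_take xA)); rewrite mem_filter => /andP[].
have : index x (alphas (word s)) < n.-1.
  by move: xA; rewrite take_takel ?leq_pred // in_take_leq ?size_alphas //; lia.
have eA' : alphas (word s) = alphas u ++ a :: twin a :: alphas v.
  by rewrite es /alphas filter_cat /= alpha_twin fa.
have := index_adjacent (u := alphas u) (a := a) (b := twin a) (v := alphas v).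
rewrite -eA' => /(_ uA) [ia ib]; rewrite size_filter cu in ia ib.
have [->|xa] := eqVneq x a; first by rewrite ia ltnn.
case: (same_index (esym ex)) => [|e|e|e]; first by rewrite eq_sym.
- by move: fx; rewrite e alpha_conj fa.
- by rewrite e ib; lia.
- by move: fx; rewrite e alpha_shift fa.
Qed.

Lemma connect_inv (T : finType) (S : Type) (e : rel T) (f : T -> S) :
  (forall i j, e i j -> f i = f j) -> forall i j, connect e i j -> f i = f j.
Proof.
move=> ef i j /connectP[p + ->]; elim: p i => //= k p IH i /andP[/ef -> /IH]; exact.
Qed.

Lemma D_equivalent_code s t : D_equivalent s t -> class_code (word s) = class_code (word t).
Proof. exact: (connect_inv (f := class_code \o word)) D_move_code _ _. Qed.

Lemma D_move_sym : symmetric (@D_move n).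
Proof.
suff h s t : D_move s t -> D_move t s by move=> s t; apply/idP/idP; apply: h.
case/orP=> [/(D_move1P _ (wordP s))|/(D_move2P _ (wordP s))].
  move=> [u [a [v [es et]]]]; apply/orP; left; apply/(D_move1P _ (wordP t)).
  by exists u, (conj_letter a), v; rewrite conj_letterK.
move=> [u [a [v [es fa et]]]]; apply/orP; right; apply/(D_move2P _ (wordP t)).
rewrite -/(word s) in es; rewrite -/(word s) -/(word t) in et.
exists (map (flip a.1.1) u), (twin a), (map (flip a.1.1) v); split; last first.
- by rewrite et -map_comp -[LHS]map_id; apply: eq_map => x /=; rewrite flipK.
- by rewrite alpha_twin.
- by rewrite /= et es map_cat /= /flip /= !eqxx.
Qed.

End Codes.

(** * Completeness of the code, and of the comparisons between different indices *)

Section Equivalence.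
Variable n : nat.
Implicit Types (a b c d x y : letter n) (w u v : seq (letter n)) (r s t : sketch n).

Lemma D_equivalent_sym : symmetric (@D_equivalent n).
Proof. apply: sym_connect_sym; exact: D_move_sym. Qed.

Lemma last_up_equivalent s : 0 < n -> exists2 t, D_equivalent s t &
  take (2 * n) (updown (word t)) = rcons (ups (word t)) true.
Proof.
move=> n0; have sw := wordP s; have sz := size_sketch sw; have [uw mw cw _ _] := sw.
have a0 : letter n := (Ordinal n0, true, true).
have i0 : (2 * n).-1 < size (word s) by rewrite sz; lia.
have i1 : 2 * n < size (word s) by rewrite sz; lia.
set a := nth a0 (word s) (2 * n).-1; set b := nth a0 (word s) (2 * n).
have ia : index a (word s) = (2 * n).-1 by rewrite index_uniq.
have ib : index b (word s) = 2 * n by rewrite index_uniq.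
have eb : b = conj_letter a.
  apply: (@index_injl _ (word s) _ _ (mw b)).
  rewrite (index_sym (can_inj (@conj_letterK n)) uw (mw a) cw) sz ib ia; lia.
have [|u [v [es su]]] := @adjacent_split n (word s) a b (mw b).
  by rewrite ib ia; lia.
have upE c c' : size u = (2 * n).-1 -> is_alpha c ->
    take (2 * n) (updown (u ++ c :: c' :: v)) = rcons (ups (u ++ c :: c' :: v)) true.
  move=> suE fc; rewrite /ups /updown !map_cat /= fc -cat_rcons.
  rewrite take_size_cat ?size_rcons ?size_map ?suE ?prednK //; last lia.
  by rewrite cat_rcons take_size_cat ?size_map.
rewrite ia in su.
have [fa|nfa] := boolP (is_alpha a).
  by exists s; [exact: connect0 | rewrite es; apply: upE].
rewrite eb in es.
have [t et] := sketch_of (sketch_swap_conj (eq_ind _ (@sketch_spec n) sw _ es)).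
exists t; last by rewrite et; apply: upE => //; rewrite alpha_conj.
apply: connect1; apply/orP; left; apply/(D_move1P _ sw).
by exists u, a, v.
Qed.

Lemma last_sign u a v : count (@is_alpha n) u = n.-1 -> 0 < n -> is_alpha a ->
  signs (u ++ a :: v) = rcons (take n.-1 (signs (u ++ a :: v))) a.1.2.
Proof.
move=> cu n0 fa; have sz : size (alphas u) = n.-1 by rewrite size_filter.
have -> : signs (u ++ a :: v) = rcons (map (fun x => x.1.2) (alphas u)) a.1.2.
  rewrite /signs /first_alphas /alphas filter_cat /= fa -/(alphas _) -cat_rcons.
  by rewrite take_size_cat ?map_rcons // size_rcons sz prednK.
by rewrite -cats1 take_size_cat ?size_map // cats1.
Qed.

(** Normal form: move (i) first makes the [2n]-th letter an alpha, so that adjacency in [ups] makes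
    move (ii) available; move (ii) then clears the last sign without disturbing the pattern. *)
Lemma canonical_equivalent s : 0 < n -> exists t, [/\ D_equivalent s t,
  take (2 * n) (updown (word t)) = rcons (ups (word t)) true &
  signs (word t) = (class_code (word t)).1.2].
Proof.
move=> n0; have [s1 ss1 e1] := last_up_equivalent s n0.
rewrite /class_code /=; have [ad|nad] := boolP (adjacent_ups n (ups (word s1))); last first.
  by exists s1; split; rewrite ?(negPf nad).
have sw := wordP s1.
have [u [a [v [es fa cu]]]] := adjacent_ups_split sw n0 e1 ad.
case: (boolP (a.1.2)) => [na|na]; last first.
  by exists s1; split=> //; rewrite ad es -(negPf na) -last_sign.
have [t et] := sketch_of (sketch_flip a.1.1 sw).
have m : D_move s1 t.
  by apply/orP; right; apply/(D_move2P _ sw); exists u, a, v.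
have ud : updown (word t) = updown (word s1).
  by rewrite et /updown -map_comp; apply: eq_map => x; rewrite /= alpha_flip.
exists t; rewrite /ups ud; split=> //; first exact: connect_trans ss1 (connect1 m).
rewrite -/(ups (word s1)) ad et es map_cat /=.
rewrite {1}last_sign ?alpha_flip //; first by congr (rcons _ _); rewrite /flip eqxx /= na.
by rewrite count_map -cu; apply: eq_count => x; rewrite /= alpha_flip.
Qed.

Lemma alphas_zip (A : seq (letter n)) : all (@is_alpha n) A ->
  A = [seq (p.1, p.2, p.2) | p <- zip (map (fun a : letter n => a.1.1) A)
                                       (map (fun a : letter n => a.1.2) A)].
Proof.
elim: A => //= a A IH /andP[fa /IH <-]; congr (_ :: _).
by move: fa; rewrite is_alphaE; case: a => [[i e] s] /= /eqP ->.
Qed.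

Lemma first_alphasP w : all (@is_alpha n) (first_alphas w).
Proof.
by apply/allP => a /mem_take; rewrite mem_filter => /andP[].
Qed.

(** For sketches in normal form the code gives back the first [n] alphas and half of the pattern,
    and [sketch_inj] applies. *)
Lemma D_equivalentP s t : 0 < n ->
  D_equivalent s t = (class_code (word s) == class_code (word t)).
Proof.
move=> n0; apply/idP/eqP => [|e]; first exact: D_equivalent_code.
have [s' [ss' us' es']] := canonical_equivalent s n0.
have [t' [tt' ut' et']] := canonical_equivalent t n0.
have e' : class_code (word s') = class_code (word t').
  by rewrite -(D_equivalent_code ss') -(D_equivalent_code tt').
suff st' : s' = t'.
  by apply: connect_trans ss' _; rewrite st' -/(D_equivalent _ _) D_equivalent_sym.
apply/word_inj/sketch_inj; try exact: wordP.
  rewrite -!/(first_alphas _) [LHS]alphas_zip ?first_alphasP // [RHS]alphas_zip ?first_alphasP //.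
  rewrite -!/(indices _) -!/(signs _) es' et' e'.
  by case: e' => ->.
by rewrite us' ut'; case: e' => _ _ ->.
Qed.

(** What a region records of a sketch: the hyperplanes compare only letters with different
    indices. *)
Definition signature w : {ffun letter n * letter n -> bool} :=
  [ffun p => (p.1.1.1 != p.2.1.1) && before w p.1 p.2].

Lemma before_swap w a b x y : (forall c, c \in w) -> index b w = (index a w).+1 ->
  before (swap a b w) x y =
    if (x == a) && (y == b) then false else
    if (x == b) && (y == a) then true else before w x y.
Proof.
move=> mw e.
have ba : (b == a) = false by apply/eqP => ba; move: e; rewrite ba => /n_Sn.
have iE z : index z (swap a b w) =
    if z == a then (index a w).+1 else if z == b then index a w else index z w.
  rewrite -{1}(tpermK a b z) index_map; last exact: perm_inj.
  by case: (tpermP a b z) => [->|->|/eqP/negPf -> /eqP/negPf ->] //; rewrite eqxx ?ba.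
have ne z : z != a -> z != b -> index z w <> index a w /\ index z w <> (index a w).+1.
  move=> /eqP za /eqP zb; split=> iz; first exact/za/(index_injl (mw z) iz).
  by apply/zb/(index_injl (mw z)); rewrite iz e.
rewrite /before !iE {iE mw}.
have [->|xa] := eqVneq x a; have [->|ya] := eqVneq y a; rewrite ?ba ?[a == b]eq_sym ?ba /=.
- by rewrite !ltnn.
- have [_|yb] := eqVneq y b; first by rewrite ltnNge leqnSn.
  by have := ne y ya yb; lia.
- have [_|xb] := eqVneq x b; first by rewrite ltnSn.
  by have := ne x xa xb; rewrite /=; lia.
have [xb|xb] := eqVneq x b; have [yb|yb] := eqVneq y b; rewrite ?xb ?yb ?andbF ?e //=.
- by have := ne y ya yb; lia.
- by have := ne x xa xb; lia.
Qed.

Lemma signature_swap w a b : (forall c, c \in w) -> index b w = (index a w).+1 ->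
  a.1.1 = b.1.1 -> signature (swap a b w) = signature w.
Proof.
move=> mw e ab; apply/ffunP => -[x y]; rewrite !ffunE /= before_swap //.
case: ifP => [/andP[/eqP -> /eqP ->]|_]; first by rewrite ab eqxx.
by case: ifP => [/andP[/eqP -> /eqP ->]|_]; first by rewrite ab eqxx.
Qed.

(** The Kendall tau distance of the two orders, used as an induction measure. *)
Definition inversions w w' :=
  #|[pred p : letter n * letter n | before w p.1 p.2 && before w' p.2 p.1]|.

Lemma inversions_swap w w' a b : (forall c, c \in w) ->
  index b w = (index a w).+1 -> before w' b a ->
  inversions (swap a b w) w' < inversions w w'.
Proof.
move=> mw e ba; apply: proper_card; apply/properP; split.
  apply/subsetP => -[x y]; rewrite !inE /= before_swap //.
  case: ifP => // _; case: ifP => // /andP[/eqP -> /eqP ->] /= ab.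
  by have := before_trans ab ba; rewrite before_irr.
exists (a, b); rewrite !inE /= ?before_swap ?eqxx ?ba //.
by rewrite /before e ltnSn.
Qed.

Lemma mem_swap w a b c : (forall c, c \in w) -> c \in swap a b w.
Proof. by move=> mw; rewrite -[c](tpermK a b) mem_map //; exact: perm_inj. Qed.

Lemma flip_swap a w :
  map (flip a.1.1) w = swap a (twin a) (swap (shift_letter a) (shift_letter (twin a)) w).
Proof. by rewrite /swap -map_comp; apply: eq_map => x; rewrite /= flip_tperm. Qed.

(** Presents move (ii) as two successive exchanges of neighbours. The letters [c] and [d] are the
    conjugates of [twin a] and [a], so they are neighbours by mirror symmetry, and exchanging them
    does not move [a] and [twin a]. *)
Lemma index_twins u a v w : w = u ++ a :: twin a :: v -> sketch_spec w ->
  let c := shift_letter a in let d := shift_letter (twin a) in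
  index d w = (index c w).+1 /\
  index (twin a) (swap c d w) = (index a (swap c d w)).+1.
Proof.
move=> ew sw; have [uw mw cw _ _] := sw; rewrite /=.
have [ia ib] : index a w = size u /\ index (twin a) w = (size u).+1.
  by rewrite ew; apply: index_adjacent; rewrite -ew.
have ec : shift_letter a = conj_letter (twin a) by rewrite -shift_twin twinK.
have iE := index_sym (can_inj (@conj_letterK n)) uw (mw _) cw.
have sz : (size u).+1 < size w by rewrite -ib index_mem.
split; first by rewrite shift_twin ec !iE ia ib subnSK.
have fx x : is_alpha x = is_alpha a ->
    index x (swap (shift_letter a) (shift_letter (twin a)) w) = index x w.
  move=> fa; rewrite /swap -[in LHS](_ : tperm (shift_letter a) (shift_letter (twin a)) x = x).
    by rewrite index_map //; exact: perm_inj.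
  by apply: tpermD; apply: contra_eq_neq fa => <-; rewrite alpha_shift ?alpha_twin; case: is_alpha.
by rewrite !fx ?alpha_twin // ia ib.
Qed.

Lemma D_move_signature s t : D_move s t -> signature (word s) = signature (word t).
Proof.
have sw := wordP s; have [uw mw _ _ _] := sw.
case/orP=> [/(D_move1P _ sw)|/(D_move2P _ sw)].
  move=> [u [a [v [es et]]]]; rewrite -/(word t) in et.
  have ei := index_adjacent (eq_ind _ uniq uw _ es).
  rewrite et -swap_split -es // signature_swap // es; by case: ei => -> ->.
move=> [u [a [v [es fa et]]]]; rewrite -/(word s) in es; rewrite -/(word s) -/(word t) in et.
rewrite et flip_swap; have [e1 e2] := index_twins es sw.
by rewrite signature_swap ?signature_swap // => c; apply: mem_swap.
Qed.

Lemma unsorted (e : rel (letter n)) w : ~~ sorted e w ->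
  exists u a b v, w = u ++ a :: b :: v /\ ~~ e a b.
Proof.
case: w => // a w; elim: w a => //= b w IH a; rewrite negb_and.
case/orP=> [ab|/IH [u [c [d [v [-> cd]]]]]]; first by exists [::], a, b, w.
by exists (a :: u), c, d, v.
Qed.

Lemma before_conj w a b : sketch_spec w ->
  before w (conj_letter b) (conj_letter a) = before w a b.
Proof.
have cI := can_inj (@conj_letterK n); case=> uw mw cw _ _.
by rewrite -{1}cw before_rev ?map_inj_uniq ?mem_map ?before_map.
Qed.

(* Two neighbours of [s] which are reversed in [t] have the same index, and are
   therefore exchanged by a move. *)
Lemma D_move_toward s t : signature (word s) = signature (word t) -> s <> t ->
  exists2 s', D_move s s' &
    inversions (word s') (word t) < inversions (word s) (word t).
Proof.
move=> est nst; have sw := wordP s; have tw := wordP t.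
have [us ms cs eBs bs] := sw; have [ut mt ct eBt bt] := tw.
have /unsorted [u [a [b [v [es nab]]]]] : ~~ sorted (before (word t)) (word s).
  apply/negP => ss; apply/nst/word_inj/(eq_sorted_before ss (sorted_before ut)).
  by move=> a; rewrite ms mt.
have [ia ib] : index a (word s) = size u /\ index b (word s) = (size u).+1.
  by rewrite es; apply: index_adjacent; rewrite -es.
have ab : before (word s) a b by rewrite /before ia ib.
have ne : a != b by apply: contraTneq ab => ->; rewrite before_irr.
have ba : before (word t) b a by rewrite (before_neq _ ) // eq_sym.
have ii : a.1.1 = b.1.1.
  apply/eqP; apply: contraNT nab => nii.
  have := congr1 (fun f : {ffun _ -> _} => f (a, b)) est.
  by rewrite !ffunE /= nii ab /= => <-.
have e1 : index b (word s) = (index a (word s)).+1 by rewrite ia ib.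
case: (same_index ii ne) => eb.
- rewrite eb in es.
  have [s' es'] := sketch_of (sketch_swap_conj (eq_ind _ (@sketch_spec n) sw _ es)).
  exists s'; first by apply/orP; left; apply/(D_move1P _ sw); exists u, a, v.
  by rewrite es' -swap_split -es // -eb; apply: inversions_swap.
- have mv u' a' v' : is_alpha a' -> word s = u' ++ a' :: twin a' :: v' ->
      before (word t) (twin a') a' -> exists2 s', D_move s s' &
      inversions (word s') (word t) < inversions (word s) (word t).
    move=> fa es' ba'; have [s' e'] := sketch_of (sketch_flip a'.1.1 sw).
    exists s'; first by apply/orP; right; apply/(D_move2P _ sw); exists u', a', v'.
    have [i1 i2] := index_twins es' sw.
    rewrite e' flip_swap; apply: ltn_trans (inversions_swap ms i1 _).
      by apply: inversions_swap => // c; apply: mem_swap.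
    by rewrite (before_shift eBt) // alpha_twin.
  have [fa|nfa] := boolP (is_alpha a); first by apply: mv fa _ _; rewrite -eb //; exact: es.
  (* If [a] and [b] are betas, their mirror images [conj_letter b] and [conj_letter a] are
     neighbouring twin alphas, also reversed in [t]. *)
  have iE := index_sym (can_inj (@conj_letterK n)) us (ms _) cs.
  have sz : (size u).+1 < size (word s) by rewrite -ib index_mem.
  have ea : conj_letter a = twin (conj_letter b).
    by rewrite eb; case: (a) => [[i e] x]; rewrite /twin /conj_letter /= !negbK.
  have [|u' [v' [es' _]]] := @adjacent_split n (word s) (conj_letter b) (conj_letter a) (ms _).
    by rewrite !iE ia ib subnSK.
  apply: (mv u' (conj_letter b) v'); last by rewrite -ea before_conj.
    by rewrite alpha_conj eb alpha_twin.
  by rewrite -ea.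
(* By (3) a letter and its shift come in the same order in every sketch, so they cannot be
   reversed. *)
- have [fa|nfa] := boolP (is_alpha a).
    by case/negP: nab; rewrite eb; apply: (ballot_before ut mt eBt bt).
  have fb : is_alpha b by rewrite eb alpha_shift.
  have /(_ _ fb) := elimT (ballot_before us ms eBs) bs; rewrite {2}eb shift_letterK => ba'.
  by have := before_trans ab ba'; rewrite before_irr.
Qed.

(** Moves exchange only letters of the same index. Conversely, [D_move_toward] lowers the number of
    inversions until the sketches coincide. *)
Lemma D_equivalent_signature s t :
  D_equivalent s t = (signature (word s) == signature (word t)).
Proof.
apply/idP/eqP => [|e].
  exact: (connect_inv (f := fun s => signature (word s))) D_move_signature _ _.
move: e.
have [k] := ubnP (inversions (word s) (word t)).
elim: k s => // k IH s lk e; have [->|/eqP st] := eqVneq s t; first exact: connect0.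
have [s' ss' lt] := D_move_toward e st.
apply: connect_trans (connect1 ss') (IH s' _ _); first exact: leq_trans lt _.
by rewrite -(D_move_signature ss').
Qed.
End Equivalence.

(** * Counting the classes *)

Section Seqs.

Lemma map_uniq_inj (T U : eqType) (f : T -> U) (s : seq T) :
  uniq (map f s) -> {in s &, injective f}.
Proof.
elim: s => //= z s IH /andP[nz us] x y; rewrite !inE.
case/predU1P=> [->|xs]; case/predU1P=> [->|ys] // e; last exact: IH e.
  by rewrite e map_f in nz.
by rewrite -e map_f in nz.
Qed.

Lemma undup_map_size (T : Type) (S U : eqType) (f : T -> S) (g : T -> U) (s : seq T) :
  (forall x y, (f x == f y) = (g x == g y)) ->
  size (undup (map f s)) = size (undup (map g s)).
Proof.
move=> fg; elim: s => //= x s IH.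
have -> : (f x \in map f s) = (g x \in map g s).
  by elim: s {IH} => //= y s IH; rewrite !inE fg IH.
by case: ifP => //= _; rewrite IH.
Qed.

Lemma card_image_undup (T U : finType) (f : T -> U) :
  #|[set f x | x in [set: T]]| = size (undup (map f (enum T))).
Proof.
rewrite -(card_uniqP (undup_uniq _)); apply: eq_card => y; rewrite mem_undup.
by apply/imsetP/mapP => -[x _ ->]; exists x; rewrite ?mem_enum ?inE.
Qed.

(** Classes of the kernel of [f] correspond to values of [f], which are listed because [S] need not
    be finite. *)
Lemma card_equivalence_partition (T : finType) (S : eqType) (R : rel T) (f : T -> S) :
  (forall x y, R x y = (f x == f y)) ->
  #|equivalence_partition R [set: T]| = size (undup (map f (enum T))).
Proof.
move=> Rf; rewrite /equivalence_partition card_image_undup.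
apply: undup_map_size => x y; apply/eqP/eqP => [e|e].
  have : y \in [set z in [set: T] | R y z] by rewrite !inE Rf eqxx.
  by rewrite -e !inE Rf => /eqP.
by apply/setP => z; rewrite !inE !Rf e.
Qed.

Lemma weave_exists (T : Type) (f : pred T) (P : seq bool) (A B : seq T) :
  count id P = size A -> count negb P = size B -> all f A -> all (predC f) B ->
  exists w, [/\ map f w = P, filter f w = A & filter (predC f) w = B].
Proof.
elim: P A B => [|[] P IH] [|a A] [|b B] //=; first by exists [::].
- rewrite !add1n ?add0n => -[cA] cB /andP[fa fA] _.
  have [w [<- <- e]] := IH A [::] cA cB fA isT.
  by exists (a :: w); rewrite /= fa e.
- rewrite !add1n ?add0n => -[cA] cB /andP[fa fA] fB.
  have [w [<- <- e]] := IH A (b :: B) cA cB fA fB.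
  by exists (a :: w); rewrite /= fa e.
- rewrite !add1n ?add0n => cA [cB] _ /andP[fb fB].
  have [w [<- e <-]] := IH [::] B cA cB isT fB.
  by exists (b :: w); rewrite /= fb e (negPf fb).
- rewrite !add1n ?add0n => cA [cB] fA /andP[fb fB].
  have [w [<- e <-]] := IH (a :: A) B cA cB fA fB.
  by exists (b :: w); rewrite /= fb e (negPf fb).
Qed.

Lemma mirror_sym (T : Type) (f : T -> T) (s : seq T) : involutive f ->
  rev (map f (s ++ rev (map f s))) = s ++ rev (map f s).
Proof.
move=> fK; rewrite map_cat rev_cat map_rev revK -map_comp; congr (_ ++ _).
by rewrite -[RHS]map_id; apply: eq_map => x /=; rewrite fK.
Qed.

(** The second half retraces the path of [p] backwards, so it only visits heights already
    visited. *)
Lemma ballot_mirror p : ballot p -> ballot (p ++ rev (map negb p)).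
Proof.
move=> /ballot_fromP bp; apply/ballot_fromP => j; rewrite take_cat.
case: ltnP => pj; first exact: bp.
rewrite take_rev !count_cat !count_rev size_map -map_drop !count_map.
move: (size p - (j - size p)) => k; have := bp k.
have := congr1 (count id) (cat_take_drop k p).
have := congr1 (count negb) (cat_take_drop k p).
rewrite !count_cat -[count id (drop k p)](eq_count (a1 := preim negb negb)); last first.
  by move=> x /=; rewrite negbK.
by rewrite -[count (preim negb id) _]/(count negb _); lia.
Qed.

Lemma ballot_take p k : ballot p -> ballot (take k p).
Proof.
move=> /ballot_fromP bp; apply/ballot_fromP => j; rewrite -take_min; exact: bp.
Qed.

Lemma ballot_rcons_true p : ballot p -> ballot (rcons p true).
Proof.
move=> /ballot_fromP bp; apply/ballot_fromP => j; rewrite -cats1 take_cat.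
case: ltnP => pj; first exact: bp.
have := bp (size p); rewrite take_size !count_cat.
by case: (j - size p) => [|k] /=; lia.
Qed.
End Seqs.

(** * The range of the code and its size *)

Section Count.
Variable n : nat.
Hypothesis n0 : 0 < n.
Implicit Types (a b c d x y : letter n) (w u v : seq (letter n)) (s : sketch n).

Definition sign_words (q : seq bool) : seq (seq bool) :=
  if adjacent_ups n q then map (rcons^~ false) (words n.-1) else words n.

Definition class_codes : seq (seq 'I_n * seq bool * seq bool) :=
  [seq (t, p.1, p.2) | t <- permutations (enum 'I_n),
     p <- [seq (e, q) | q <- filter ballot (words (2 * n).-1), e <- sign_words q]].

Lemma sign_wordsP q e : reflect
  (size e = n /\ (adjacent_ups n q -> e = rcons (take n.-1 e) false)) (e \in sign_words q).
Proof.
rewrite /sign_words; case: (adjacent_ups n q).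
  apply: (iffP mapP) => [[e' + ->]|[se /(_ isT) ->]].
    rewrite mem_words => /eqP se; rewrite size_rcons se prednK //; split=> // _.
    by rewrite -cats1 take_size_cat // cats1.
  exists (take n.-1 e); rewrite // mem_words size_takel // se; lia.
by rewrite mem_words; apply: (iffP eqP) => [|[]].
Qed.

Lemma class_codesP (c : seq 'I_n * seq bool * seq bool) : reflect
  [/\ perm_eq c.1.1 (enum 'I_n), size c.2 = (2 * n).-1, ballot c.2 & c.1.2 \in sign_words c.2]
  (c \in class_codes).
Proof.
case: c => [[t e] q] /=; apply: (iffP allpairsP).
  case=> [[t' [e' q']] /= [pt + [-> -> ->]]].
  case/allpairsPdep=> q1 [e1 [q1b e1w [-> ->]]].
  move: q1b; rewrite mem_filter mem_words => /andP[-> /eqP ->].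
  by rewrite -mem_permutations.
case=> pt sq bq eq; exists (t, (e, q)); split=> //=; first by rewrite mem_permutations.
by apply/allpairsPdep; exists q, e; rewrite mem_filter mem_words sq bq eqxx.
Qed.

Lemma class_codes_uniq : uniq class_codes.
Proof.
apply: allpairs_uniq; first exact: permutations_uniq; last first.
  by move=> [t [e q]] [t' [e' q']] _ _ /= [-> -> ->].
apply: allpairs_uniq_dep; first by rewrite filter_uniq // words_uniq.
  move=> q _; rewrite /sign_words; case: ifP => _; rewrite ?map_inj_uniq ?words_uniq //.
  by move=> e e' /rcons_inj[].
by move=> [q e] [q' e'] _ _ /= [-> ->].
Qed.

Lemma size_sign_words (Q : seq (seq bool)) :
  sumn [seq size (sign_words q) | q <- Q] =
  2 ^ n.-1 * (count (adjacent_ups n) Q + 2 * count (predC (adjacent_ups n)) Q).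
Proof.
elim: Q => [|q Q IH] /=; first by rewrite !muln0.
have e2 : 2 ^ n = 2 ^ n.-1 * 2 by rewrite -expnSr prednK.
rewrite IH /sign_words; case: (adjacent_ups n q); rewrite ?size_map !size_words; nia.
Qed.

Lemma size_class_codes : size class_codes =
  2 ^ (n - 1) * ((2 * n - 2)`! %/ (n - 1)`!) * (3 * n - 2).
Proof.
rewrite size_allpairs size_permutations ?enum_uniq // size_enum_ord size_allpairs_dep.
rewrite size_sign_words; set Q := filter _ _.
pose m := n.-1; have em : n = m.+1 by rewrite prednK.
have e1 : (2 * n).-1 = m.*2.+1 by lia.
have cN : count (adjacent_ups n) Q = 'C(m.*2, m).
  rewrite -count_adjacent_ballot /Q e1 count_filter em; apply: eq_count => q.
  exact: andbC.
have cT : count (adjacent_ups n) Q + count (predC (adjacent_ups n)) Q = 'C(m.*2.+1, m.+1).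
  rewrite count_predC size_filter e1 count_ballot; congr 'C(_, _); lia.
have cD : m.*2.+1 * 'C(m.*2, m) = m.+1 * 'C(m.*2.+1, m.+1) by exact: mul_bin_diag.
have cF : (2 * n - 2)`! %/ (n - 1)`! = 'C(m.*2, m) * m`!.
  have -> : 2 * n - 2 = m.*2 by lia.
  have -> : n - 1 = m by lia.
  rewrite -(@bin_fact m.*2 m); last lia.
  have -> : m.*2 - m = m by lia.
  by rewrite mulnA mulnK // fact_gt0.
rewrite cN in cT *; rewrite -cT in cD; rewrite cF {cF cN cT}.
move: (count _ Q) cD => M; have -> : n - 1 = m by lia.
have -> : 3 * n - 2 = (3 * m).+1 by lia.
have -> : n`! = m.+1 * m`! by rewrite em factS.
rewrite -/m; move: 'C(_, _) => C; move: m`! (2 ^ m) => F E cD.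
(* Here [C] counts the adjacent words and [M] the others. From [(m + 1)(C + M) = (2m + 1)C] follows
   [(m + 1)(C + 2M) = 2(2m + 1)C - (m + 1)C], and [3m + 1 = 3n - 2]. *)
have : m.+1 * (C + 2 * M) = C * (3 * m).+1 by lia.
move=> e; have -> : m.+1 * F * (E * (C + 2 * M)) = E * F * (m.+1 * (C + 2 * M)) by lia.
by rewrite e; lia.
Qed.

(** Two alphas with the same index are twins, hence in mirror places, and cannot both be in the
    first half. *)
Lemma indices_perm w : sketch_spec w -> perm_eq (indices w) (enum 'I_n).
Proof.
move=> sw; have [uw mw _ _ _] := sw; have sA := size_alphas sw.
have uA : uniq (alphas w) by rewrite filter_uniq.
have sI : size (indices w) = n by rewrite size_map size_takel // sA; lia.
have uI : uniq (indices w).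
  rewrite map_inj_in_uniq ?take_uniq // => x y xA yA e.
  have [//|xy] := eqVneq x y.
  have fx : is_alpha x by move: (mem_take xA); rewrite mem_filter => /andP[].
  have fy : is_alpha y by move: (mem_take yA); rewrite mem_filter => /andP[].
  case: (same_index e xy) => eq.
  - by move: fy; rewrite eq alpha_conj fx.
  - move: xA yA; rewrite !in_take_leq ?sA ?eq ?index_twin //; lia.
  - by move: fy; rewrite eq alpha_shift fx.
apply: uniq_perm; rewrite ?enum_uniq //.
have sub : {subset indices w <= enum 'I_n} by move=> i _; rewrite mem_enum.
by have [] := uniq_min_size uI sub _; rewrite // size_enum_ord sI.
Qed.

Lemma class_code_mem s : class_code (word s) \in class_codes.
Proof.
have sw := wordP s; have [_ _ _ _ bw] := sw.
have ss : size (signs (word s)) = n.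
  by rewrite size_map size_takel // size_alphas //; lia.
apply/class_codesP; split=> /=.
- exact: indices_perm.
- by rewrite size_takel // size_map size_sketch //; lia.
- exact: ballot_take.
apply/sign_wordsP; case: ifP => // _.
have st : size (take n.-1 (signs (word s))) = n.-1 by rewrite size_takel // ss; lia.
by rewrite size_rcons st prednK //; split=> // _; congr (rcons _ _); rewrite -cats1 take_size_cat.
Qed.

(** Indices and signs give the first [n] alphas [h]; mirroring yields all alphas [A] and the pattern
    [P], and [A] is woven with its shifts along [P]. *)
Lemma class_code_surj k : k \in class_codes -> exists s, class_code (word s) = k.
Proof.
case/class_codesP; case: k => [[t e] q] /= pt sq bq /sign_wordsP[se ad].
have st : size t = n by rewrite (perm_size pt) size_enum_ord.
have ut : uniq t by rewrite (perm_uniq pt) enum_uniq.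
pose h : seq (letter n) := [seq (p.1, p.2, p.2) | p <- zip t e].
have ht : map (fun a : letter n => a.1.1) h = t.
  by rewrite -map_comp -[RHS](unzip1_zip (t := e)) ?st ?se.
have he : map (fun a : letter n => a.1.2) h = e.
  by rewrite -map_comp -[RHS](unzip2_zip (s := t)) ?st ?se.
have hh : size h = n by rewrite -(size_map (fun a : letter n => a.1.1)) ht.
have ha : all (@is_alpha n) h.
  by apply/allP => a /mapP[p _ ->]; rewrite is_alphaE.
pose A := h ++ rev (map (@twin n) h).
(* A final up keeps [q] ballot at any height; as the [2n]-th letter it is invisible in [ups]. *)
pose p := rcons q true; pose P := p ++ rev (map negb p).
have sp : size p = 2 * n by rewrite size_rcons sq; lia.
have sA : size A = 2 * n by rewrite size_cat size_rev size_map hh; lia.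
have aA : all (@is_alpha n) A.
  rewrite all_cat ha all_rev all_map; apply: sub_all ha => a fa.
  by rewrite /= alpha_twin.
have cP : count id P = 2 * n.
  by rewrite count_cat count_rev count_map -sp -(count_ids p); congr addn; apply: eq_count.
have cP' : count negb P = 2 * n.
  have := count_ids P; rewrite cP size_cat size_rev size_map sp; lia.
have [||||w [wP wA wB]] := @weave_exists _ (@is_alpha n) P A (map (@shift_letter n) A).
- by rewrite sA.
- by rewrite size_map sA.
- exact: aA.
- by rewrite all_map; apply: sub_all aA => a fa /=; rewrite alpha_shift fa.
have sI := can_inj (@shift_letterK n); have tI := can_inj (@twinK n).
have uh : uniq h by apply: (@map_uniq _ _ (fun a : letter n => a.1.1)); rewrite ht.
have uA : uniq A.
  rewrite cat_uniq uh rev_uniq map_inj_uniq // uh andbT /=.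
  apply/hasPn => b; rewrite mem_rev => /mapP[a ah ->]; apply/negP => /= th.
  have uh' : uniq (map (fun a : letter n => a.1.1) h) by rewrite ht.
  have := map_uniq_inj uh' th ah erefl; case: (a) => [[? []] ?] //.
have sw : sketch_spec w.
  have uw : uniq w.
    rewrite -(perm_uniq (permEl (perm_filterC (@is_alpha n) w))) wA wB cat_uniq uA.
    rewrite map_inj_uniq // uA andbT; apply/hasPn => b /mapP[a aA' ->]; apply/negP => /= h'.
    by have := allP aA _ h'; rewrite /= alpha_shift (allP aA _ aA').
  have szw : size w = 4 * n.
    by rewrite -(size_map (@is_alpha n)) wP size_cat size_rev size_map sp; lia.
  have mw a : a \in w.
    have sub : {subset w <= enum {: letter n}} by move=> b _; rewrite mem_enum.
    have [] := uniq_min_size uw sub _; last by move=> _ ->; rewrite mem_enum.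
    by rewrite -cardE !card_prod card_ord card_bool szw; lia.
  have wB' : filter (@is_beta n) w = map (@shift_letter n) A by rewrite -wB.
  have fr (f g : pred (letter n)) : (forall a, f (conj_letter a) = g a) ->
      filter f (rev (map (@conj_letter n) w)) = rev (map (@conj_letter n) (filter g w)).
    by move=> fg; rewrite filter_rev filter_map; congr (rev (map _ _)); apply: eq_filter => a /=.
  have symA : rev (map (@twin n) A) = A by apply: mirror_sym; exact: twinK.
  split=> //.
  (* Mirror symmetry is checked separately on the pattern, the alphas and the betas. *)
  - apply: (@proj_inj n (@is_alpha n)).
    + rewrite wP map_rev -map_comp -[RHS](mirror_sym p negbK) -/P -wP -map_comp.
      by congr rev; apply: eq_map => a /=; rewrite alpha_conj.
    + rewrite (fr _ (@is_beta n)) => [|a]; last by rewrite alpha_conj.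
      by rewrite wB' wA -[RHS]symA -map_comp.
    + rewrite (fr _ (@is_alpha n)) => [|a]; last by rewrite /= alpha_conj negbK.
      rewrite wB wA -{2}symA map_rev -map_comp; congr rev; apply: eq_map => a /=.
      by rewrite shift_twin.
  - by rewrite wB' wA.
  - by rewrite wP; apply/ballot_mirror/ballot_rcons_true.
have [s es] := sketch_of sw; exists s; rewrite es.
have eh : first_alphas w = h by rewrite /first_alphas /alphas wA take_size_cat.
have eq : ups w = q by rewrite /ups /updown wP /P /p cat_rcons take_size_cat.
rewrite /class_code /indices /signs eh eq ht he; case: ifP => // /ad <-.
by [].
Qed.

Lemma card_D_classes : #|D_classes n| =
  2 ^ (n - 1) * ((2 * n - 2)`! %/ (n - 1)`!) * (3 * n - 2).
Proof.
rewrite (card_equivalence_partition (f := @class_code n \o @word n)); last first.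
  by move=> s s'; rewrite D_equivalentP.
rewrite -size_class_codes; apply/perm_size/uniq_perm; rewrite ?undup_uniq ?class_codes_uniq //.
move=> c; rewrite mem_undup; apply/mapP/idP => [[s _ ->]|]; first exact: class_code_mem.
by case/class_code_surj => s <-; exists s; rewrite ?mem_enum.
Qed.
End Count.

(** * Regions *)

(* Imported only here because these files rebind [filter]. *)
From mathcomp Require Import all_classical all_reals all_analysis.
From mathcomp Require Import ring lra.

Import Order.TTheory GRing.Theory Num.Theory.
Import numFieldNormedType.Exports.

Section Cardinality.
Local Open Scope classical_set_scope.

(** Both images are projections of the image under the pair of [f] and [g], and both projections are
    injective there. *)
Lemma card_eq_images (T U V : Type) (A : set T) (f : T -> U) (g : T -> V) :
  (forall x y, A x -> A y -> f x = f y <-> g x = g y) -> (f @` A #= g @` A)%card.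
Proof.
move=> fg; pose G := (fun x => (f x, g x)) @` A.
have e1 : f @` A = fst @` G by rewrite /G image_comp.
have e2 : g @` A = snd @` G by rewrite /G image_comp.
have h1 : (fst @` G #= G)%card.
  apply: inj_card_eq => _ _ /set_mem[x Ax <-] /set_mem[y Ay <-] /= e.
  by rewrite e (fg x y Ax Ay).1.
have h2 : (snd @` G #= G)%card.
  apply: inj_card_eq => _ _ /set_mem[x Ax <-] /set_mem[y Ay <-] /= e.
  by rewrite e (fg x y Ax Ay).2.
by rewrite e1 e2; apply: card_eq_trans h1 _; rewrite card_eq_sym.
Qed.

Lemma card_eq_seq (T : eqType) (s : seq T) : uniq s -> ([set x | x \in s] #= `I_(size s))%card.
Proof.
move=> us; case es: s => [|x0 s']; rewrite -?es.
  by rewrite es II0 card_eq0; apply/eqP/seteqP; split.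
have -> : [set x | x \in s] = nth x0 s @` `I_(size s).
  apply/seteqP; split=> [x xs|_ [i /= il <-]]; last exact: mem_nth.
  by exists (index x s); rewrite /= ?index_mem ?nth_index.
apply: inj_card_eq => i j /set_mem il /set_mem jl e; apply/eqP.
by rewrite -(nth_uniq x0 il jl us) e.
Qed.

End Cardinality.

(** * Real values for the letters of a sketch *)

Section Realization.
Local Open Scope ring_scope.
Variables (R : realType) (n : nat).
Implicit Types (a b c d : letter n) (w u : seq (letter n)) (x y z : 'rV[R]_n).

(** The midpoint of [p], an upper bound of [L] still below [U], and [q], a lower bound of [U] above
    [p]. Building them by induction covers empty lists. *)
Lemma real_between (L U : seq R) : (forall l m, l \in L -> m \in U -> l < m) ->
  exists t, (forall l, l \in L -> l < t) /\ (forall m, m \in U -> t < m).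
Proof.
move=> LU.
have [p [pL pU]] : exists p, (forall l, l \in L -> l <= p) /\ (forall m, m \in U -> p < m).
  elim: L LU => [_|l L IH LU].
    elim: U => [|m U [p [_ pU]]]; first by exists 0.
    exists (Num.min p (m - 1)); split=> // k; rewrite inE => /predU1P[->|/pU pk].
      by rewrite gt_min; apply/orP; right; lra.
    by rewrite gt_min pk.
  have [k m kL mU|p [pL pU]] := IH; first by apply: LU => //; rewrite inE kL orbT.
  exists (Num.max p l); split=> [k|m mU].
    by rewrite inE le_max => /predU1P[->|/pL ->] //; rewrite lexx orbT.
  by rewrite gt_max pU // LU // mem_head.
have [q [pq qU]] : exists q, p < q /\ (forall m, m \in U -> q <= m).
  elim: U pU {LU} => [_|m U IH pU]; first by exists (p + 1); split=> //; lra.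
  have [k kU|q [pq qU]] := IH; first by apply: pU; rewrite inE kU orbT.
  exists (Num.min q m); split; first by rewrite lt_min pq pU // mem_head.
  by move=> k; rewrite inE ge_min => /predU1P[->|/qU ->] //; rewrite lexx orbT.
exists ((p + q) / 2); split=> [l /pL|m /qU]; lra.
Qed.

Lemma before_cat u w a b : uniq (u ++ w) -> a \in u -> b \in w -> before (u ++ w) a b.
Proof.
rewrite cat_uniq => /and3P[_ /hasPn uw _] au bw.
by rewrite /before !index_cat au (negPf (uw b bw)) ltn_addr // index_mem.
Qed.

(* The values of the alphas are chosen greedily along [w]: the value of an alpha
   must lie above those of the letters before it and below those of the remaining
   betas which are already determined. *)
Lemma prefix_realization w u (z : seq (letter n)) : sketch_spec w -> w = u ++ z ->
  exists v : letter n -> R, (forall a, is_alpha a -> v (shift_letter a) = v a + 1) /\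
   (forall a b, a \in u -> b \in u \/ (is_beta b /\ shift_letter b \in u) ->
     before w a b -> v a < v b).
Proof.
move=> sw; have [uw mw cw eB bw] := sw.
have bs := elimT (ballot_before uw mw eB) bw.
elim/last_ind: u z => [|u c IH] z ew.
  (* No letter is compared yet, so any values one apart on each alpha and its shift serve. *)
  exists (fun a => (is_beta a : nat)%:R); split=> // a fa.
  by rewrite /is_beta alpha_shift fa /= add0r.
have [|v [vs vb]] := IH (c :: z); first by rewrite ew cat_rcons.
have uc d : d \in u -> before w d c.
  by move=> du; rewrite ew cat_rcons before_cat -?cat_rcons -?ew ?mem_head.
have cu : c \notin u by apply/negP => /uc; rewrite before_irr.
have nc d : before w c d -> d \notin u.
  by move=> cd; apply/negP => /uc dc; have := before_trans cd dc; rewrite before_irr.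
have [fc|fc] := boolP (is_alpha c); last first.
  (* A beta needs no new value: by (3) its alpha occurs earlier and has fixed it. *)
  have fc' : is_alpha (shift_letter c) by rewrite alpha_shift.
  have scu : shift_letter c \in u.
    have sc : before w (shift_letter c) c by rewrite -[X in before _ _ X]shift_letterK bs.
    have := mw (shift_letter c); rewrite {1}ew mem_cat mem_rcons inE.
    case/orP=> [/predU1P[e|//]|cz]; first by rewrite e before_irr in sc.
    have cs : before w c (shift_letter c).
      by rewrite ew before_cat -?ew // mem_rcons mem_head.
    by have := before_trans sc cs; rewrite before_irr.
  exists v; split=> // a b; rewrite !mem_rcons !inE.
  case/predU1P=> [->|au] bu ab.
    have bnu := nc _ ab; case: bu => [/predU1P[e|]|[fb /predU1P[e|su]]].
    - by rewrite e before_irr in ab.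
    - by rewrite (negPf bnu).
    - by rewrite -e alpha_shift negbK in fc; rewrite /is_beta fc in fb.
    - have fb' : is_alpha (shift_letter b) by rewrite alpha_shift.
      (* By (2) two betas compare as their alphas do, and both alphas lie in [u]. *)
      rewrite -[c]shift_letterK -[b]shift_letterK (vs _ fc') (vs _ fb') ltrD2r.
      have h : before w (shift_letter c) (shift_letter b).
        by rewrite -(before_shift eB fc' fb') !shift_letterK.
      by apply: vb h; [exact: scu | left; exact: su].
  apply: vb => //; case: bu => [/predU1P[->|bu]|[fb /predU1P[e|su]]].
  - by right; split.
  - by left.
  - by rewrite -e alpha_shift negbK in fc; rewrite /is_beta fc in fb.
  - by right; split.
have scu : shift_letter c \notin u by apply/nc/bs.
have scc : (shift_letter c == c) = false.
  by apply/negP => /eqP /(congr1 (@is_alpha n)); rewrite alpha_shift fc.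
have [|t [tL tU]] := @real_between (map v u)
    (map v [seq b <- z | is_beta b && (shift_letter b \in u)]).
  move=> l m /mapP[a au ->] /mapP[b]; rewrite mem_filter => /andP[/andP[fb sb] bz] ->.
  apply: vb => //; first by right.
  by rewrite ew cat_rcons before_cat -?cat_rcons -?ew // inE bz orbT.
pose v' d := if d == c then t else if d == shift_letter c then t + 1 else v d.
have v'u d : d \in u -> v' d = v d.
  move=> du; rewrite /v'; case: eqP du => [->|_ du]; first by rewrite (negPf cu).
  by case: eqP du => [->|//]; rewrite (negPf scu).
have v'c : v' c = t by rewrite /v' eqxx.
have v'sc : v' (shift_letter c) = t + 1 by rewrite /v' scc eqxx.
have v'b b : is_beta b -> shift_letter b \in u -> v' b = v b.
  move=> fb su; rewrite /v'; case: eqP fb => [->|_ _]; first by rewrite /is_beta fc.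
  by case: eqP su => [->|//]; rewrite shift_letterK (negPf cu).
exists v'; split=> [a fa|a b].
  have [->|ac] := eqVneq a c; first by rewrite v'c v'sc.
  rewrite /v' (negPf ac) ifN; last first.
    by apply: contraTneq fa => sac; rewrite -[a]shift_letterK alpha_shift sac fc.
  rewrite ifN; last by apply: contraNneq ac => /(can_inj (@shift_letterK n)) ->.
  by rewrite ifN ?vs //; apply: contraTneq fa => ->; rewrite alpha_shift fc.
rewrite !mem_rcons !inE => /predU1P[->|au] bu ab.
  rewrite v'c; have bnu := nc _ ab; case: bu => [/predU1P[e|]|[fb /predU1P[e|su]]].
  - by rewrite e before_irr in ab.
  - by rewrite (negPf bnu).
  - by rewrite -[b]shift_letterK e v'sc; lra.
  - rewrite v'b //; apply/tU/map_f; rewrite mem_filter fb su /=.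
    have := mw b; rewrite ew mem_cat mem_rcons inE (negPf bnu) orbF.
    by case/orP=> // /eqP e; rewrite e before_irr in ab.
rewrite v'u //; have at_ : v a < t by apply/tL/map_f.
case: bu => [/predU1P[->|bu]|[fb /predU1P[e|su]]].
- by rewrite v'c.
- by rewrite v'u //; apply: vb => //; left.
- by rewrite -[b]shift_letterK e v'sc; lra.
- by rewrite v'b //; apply: vb => //; right.
Qed.
End Realization.

(** * Points off the hyperplanes and their sketches *)

Section PointSketches.
Local Open Scope classical_set_scope.
Local Open Scope ring_scope.
Variables (R : realType) (n : nat).
Implicit Types (a b c d : letter n) (w u : seq (letter n)) (x y z : 'rV[R]_n).

Definition letter_value x a : R :=
  if a.1.2 then - (x 0 a.1.1 + (a.2 : nat)%:R) else x 0 a.1.1 + (a.2 : nat)%:R.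

Lemma letter_value_conj x a : letter_value x (conj_letter a) = - letter_value x a.
Proof. by rewrite /letter_value /=; case: a.1.2; rewrite ?opprK. Qed.

Lemma letter_value_shift x a : is_alpha a ->
  letter_value x (shift_letter a) = letter_value x a + 1.
Proof.
rewrite is_alphaE /letter_value /=; case: a => [[i e] s] /= /eqP ->.
by case: s => /=; ring.
Qed.

Local Notation C := (arrangement_complement (D_arrangement R n)).

(** The hyperplanes are exactly the ties between letters with different indices: equal signs give
    the differences of coordinates, opposite signs the sums. *)
Lemma arrangement_complementP x : C x <->
  forall a b, a.1.1 != b.1.1 -> letter_value x a != letter_value x b.
Proof.
split=> [Cx|vx [H [i [j [ij Hij]]]] Hx].
  have lt_neq a b : (a.1.1 < b.1.1)%N -> letter_value x a != letter_value x b.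
    case: a b => [[i e] s] [[j f] t] /= ij; apply/eqP; rewrite /letter_value /= => eab.
    case: Cx; case: (eqVneq e f) => ef.
      have eab' : x 0 i - x 0 j = (t : nat)%:R - (s : nat)%:R.
        by rewrite ef in eab; case: f eab {ef} => eab; lra.
      exists [set z : 'rV[R]_n | z 0 i - z 0 j = (t : nat)%:R - (s : nat)%:R] => //.
      exists i, j; split=> //; right; exists ((t : nat)%:R - (s : nat)%:R) => //.
      by case: s t {eab eab'} => [] []; rewrite !inE ?subrr ?subr0 ?sub0r ?eqxx ?orbT.
    have eab' : x 0 i + x 0 j = - (t : nat)%:R - (s : nat)%:R.
      by case: e f ef eab => [] [] //= _ eab; lra.
    exists [set z : 'rV[R]_n | z 0 i + z 0 j = - (t : nat)%:R - (s : nat)%:R] => //.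
    exists i, j; split=> //; left; exists (- (t : nat)%:R - (s : nat)%:R) => //.
    by rewrite !inE; apply/or3P; case: s t {eab eab'} => [] [] /=;
      [apply: Or31|apply: Or32|apply: Or32|apply: Or33]; apply/eqP; ring.
  move=> a b; rewrite -val_eqE neq_ltn => /orP[/lt_neq //|/lt_neq]; by rewrite eq_sym.
have vx' a b : letter_value x a = letter_value x b -> a.1.1 = b.1.1.
  by move=> e; apply/eqP; apply: contraTT isT => /vx; rewrite e eqxx.
have {ij} ne : i <> j by move=> ij'; rewrite ij' ltnn in ij.
(* Each of the six equations is the tie of one explicit pair of letters. *)
case: Hij => [[c + eH]|[c + eH]]; move: Hx; rewrite eH /= => <-; rewrite !inE.
  case/or3P => /eqP e; apply: ne.
  - by apply: (vx' (i, false, true) (j, true, true)); rewrite /letter_value /=; lra.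
  - by apply: (vx' (i, false, true) (j, true, false)); rewrite /letter_value /=; lra.
  - by apply: (vx' (i, false, false) (j, true, false)); rewrite /letter_value /=; lra.
case/or3P => /eqP e; apply: ne.
- by apply: (vx' (i, false, true) (j, false, false)); rewrite /letter_value /=; lra.
- by apply: (vx' (i, false, false) (j, false, false)); rewrite /letter_value /=; lra.
- by apply: (vx' (i, false, false) (j, false, true)); rewrite /letter_value /=; lra.
Qed.

Lemma sketch_realization w : sketch_spec w -> exists x,
  forall a b, before w a b -> letter_value x a < letter_value x b.
Proof.
move=> sw; have [uw mw _ _ _] := sw.
have [|v [vs vb]] := @prefix_realization R n w w [::] sw; first by rewrite cats0.
have {}vb a b : before w a b -> v a < v b by move=> ab; apply: vb => //; left.
(* Averaging [v] with its image under conjugation makes it symmetric. *)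
pose v' a := (v a - v (conj_letter a)) / 2.
have v'b a b : before w a b -> v' a < v' b.
  move=> ab; have := vb _ _ ab; have : v (conj_letter b) < v (conj_letter a).
    by apply: vb; rewrite before_conj.
  by rewrite /v'; lra.
have v'c a : v' (conj_letter a) = - v' a.
  by rewrite /v' conj_letterK; lra.
have v's a : is_alpha a -> v' (shift_letter a) = v' a + 1.
  (* As [conj_letter a] is the shift of [twin a], the two averages are [(v a + 1 - v (twin a)) / 2]
     and [(v a - v (twin a) - 1) / 2]. *)
  move=> fa; rewrite /v' conj_shift vs // -(shift_twin a) vs ?alpha_twin //.
  by lra.
exists (\row_i v' (i, false, false)).
suff vE a : letter_value (\row_i v' (i, false, false)) a = v' a.
  by move=> a b; rewrite !vE; apply: v'b.
have vE0 i s : letter_value (\row_i v' (i, false, false)) (i, false, s) = v' (i, false, s).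
  rewrite /letter_value /= mxE; case: s => /=; last by rewrite addr0.
  by rewrite -v's // is_alphaE.
case: a => [[i e] s]; case: e => //.
by rewrite -[(i, true, s)]/(conj_letter (i, false, s)) letter_value_conj vE0 v'c.
Qed.

Definition point_signature x : {ffun letter n * letter n -> bool} :=
  [ffun p => (p.1.1.1 != p.2.1.1) && (letter_value x p.1 < letter_value x p.2)].

Lemma sketch_point w : sketch_spec w -> exists2 x, C x & point_signature x = signature w.
Proof.
move=> sw; have [uw mw _ _ _] := sw; have [x xb] := sketch_realization sw.
have cmp a b : a.1.1 != b.1.1 -> before w a b = (letter_value x a < letter_value x b).
  move=> ab; apply/idP/idP => [/xb //|]; apply: contraTT.
  rewrite (before_neq (mw a)) ?negbK => [/xb/ltW|]; first by rewrite leNgt.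
  by apply: contraNneq ab => ->.
exists x.
  apply/arrangement_complementP => a b ab; rewrite neq_lt -!cmp // 1?eq_sym //.
  rewrite (before_neq (mw a)) ?orNb //; by apply: contraNneq ab => ->.
by apply/ffunP => -[a b]; rewrite !ffunE /=; case: eqVneq => //= ab; rewrite cmp.
Qed.

(* Ties [x_i + s = - x_i - t] are broken in favour of the negative subscript, as if
   [x] had been moved infinitesimally in the direction (1, .., 1). *)
Definition letter_le x : rel (letter n) := fun a b =>
  (letter_value x a < letter_value x b) ||
  (letter_value x a == letter_value x b) && (a.1.2 || ~~ b.1.2).

(** The letters are sorted by [letter_le]. Off the hyperplanes ties occur only between letters of
    one index with opposite signs, so the order is antisymmetric. Conjugation negates values and
    reverses signs, giving (1); shifting alphas adds 1 and keeps signs, giving (2) and (3). *)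
Lemma point_sketch x : C x -> exists2 w, sketch_spec w & signature w = point_signature x.
Proof.
move=> /arrangement_complementP Cx.
have le_total : total (letter_le x).
  move=> a b; rewrite /letter_le; case: ltgtP => //= _.
  by case: a.1.2; case: b.1.2.
have le_trans : transitive (letter_le x).
  move=> b a c; rewrite /letter_le; case: ltgtP => //= ab.
    by move=> _ /orP[/(lt_trans ab) ->|/andP[/eqP <- _]] //; rewrite ab.
  rewrite ab; case: ltgtP => //=; by case: a.1.2; case: b.1.2.
have le_anti a b : letter_le x a b -> letter_le x b a -> a = b.
  rewrite /letter_le; case: (ltgtP (letter_value x a)) => //= e ab ba.
  have ii : a.1.1 = b.1.1 by apply/eqP; apply: contraTT isT => /Cx; rewrite e eqxx.
  move: e ab ba ii; rewrite /letter_value.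
  case: a b => [[i f] s] [[j g] t] /= + + + ij; subst j.
  case: f g => [] [] //= e _ _; congr (_, _, _);
    by case: s t e => [] [] //= e; exfalso; lra.
pose w := sort (letter_le x) (enum {: letter n}).
have uw : uniq w by rewrite sort_uniq enum_uniq.
have mw a : a \in w by rewrite mem_sort mem_enum.
have sorted_w : sorted (letter_le x) w by apply: sort_sorted.
have bE a b : a != b -> before w a b = letter_le x a b.
  move=> ab; apply/idP/idP => [|lab].
    exact: (sorted_ltn_index le_trans sorted_w _ _ (mw a) (mw b)).
  rewrite (before_neq (mw a) ab); apply/negP => ba.
  have := sorted_ltn_index le_trans sorted_w _ _ (mw b) (mw a) ba.
  by move=> /(le_anti _ _ lab) e; rewrite e eqxx in ab.
have bne a b : before w a b -> a != b by apply: contraTneq => ->; rewrite before_irr.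
exists w; last first.
  apply/ffunP => -[a b]; rewrite !ffunE /=; case: eqVneq => //= ab.
  rewrite bE; last by apply: contraNneq ab => ->.
  by rewrite /letter_le (negPf (Cx _ _ ab)) orbF.
apply/sketchP/and4P; split.
- by apply/forallP => a; rewrite count_uniq_mem // mw.
- apply/forallP => a; apply/forallP => b; apply/implyP => ab.
  have ne := bne _ _ ab; move: ab; rewrite !bE //; last first.
    by rewrite (inj_eq (can_inj (@conj_letterK n))) eq_sym.
  by rewrite /letter_le !letter_value_conj ltrN2 eqr_opp /= negbK [~~ _ || _]orbC eq_sym.
- apply/forallP => a; apply/forallP => b; apply/forallP => a'; apply/forallP => b'.
  apply/implyP; rewrite !shift_ofE => /and3P[/andP[fa /eqP ->] /andP[fb /eqP ->]] ab.
  have ne := bne _ _ ab; move: ab; rewrite !bE //; last first.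
    by rewrite (inj_eq (can_inj (@shift_letterK n))).
  by rewrite /letter_le !letter_value_shift // ltrD2r (inj_eq (addIr _)).
- apply/forallP => a; apply/forallP => b; apply/implyP; rewrite shift_ofE => /andP[fa /eqP ->].
  rewrite bE; last by apply/eqP => /(congr1 (@is_alpha n)); rewrite alpha_shift fa.
  by rewrite /letter_le letter_value_shift // ltrDl ltr01.
Qed.

Lemma letter_value_affine x y (t : R) a :
  letter_value (x + t *: (y - x)) a = (1 - t) * letter_value x a + t * letter_value y a.
Proof. by rewrite /letter_value !mxE; case: a.1.2; ring. Qed.

End PointSketches.

(** * Regions as classes of points with equal comparisons *)

Section Regions.
Local Open Scope classical_set_scope.
Local Open Scope ring_scope.
Variables (R : realType) (n : nat).
Implicit Types (a b : letter n.+1) (x y z : 'rV[R]_n.+1).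
Local Notation C := (arrangement_complement (D_arrangement R n.+1)).

Lemma continuous_letter_value a : continuous (fun x => letter_value x a).
Proof.
have hc : continuous (fun x => x 0 a.1.1) := @coord_continuous R 1 n.+1 0 a.1.1.
have h : continuous (fun x => x 0 a.1.1 + (a.2 : nat)%:R).
  by move=> x; have := continuousD (hc x) (@cst_continuous _ _ ((a.2 : nat)%:R : R) x).
by rewrite /letter_value; case: a.1.2 => // x; exact: (continuousN (h x)).
Qed.

(** If two points of one region compared two letters of different indices differently, the
    difference of values would vanish somewhere in this connected set, which is a tie. Conversely,
    equal strict comparisons at both ends persist along the segment, which thus avoids all
    hyperplanes. *)
Lemma same_region x y : C x -> C y ->
  connected_component C x = connected_component C y <->
  point_signature x = point_signature y.
Proof.
move=> Cx Cy; have [/arrangement_complementP vx /arrangement_complementP vy] := (Cx, Cy).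
split=> [e|e].
  suff lt_imp x' y' a b : connected_component C x' = connected_component C y' ->
      C x' -> C y' -> a.1.1 != b.1.1 ->
      letter_value x' a < letter_value x' b -> letter_value y' a < letter_value y' b.
    apply/ffunP => -[a b]; rewrite !ffunE /=; case: eqVneq => //= ab.
    by apply/idP/idP; apply: lt_imp.
  move=> {x y Cx Cy vx vy}{}e Cx Cy ab lab.
  have /arrangement_complementP vy := Cy.
  rewrite ltNge le_eqVlt eq_sym (negPf (vy _ _ ab)) /=; apply/negP => lba.
  pose f z := letter_value z b - letter_value z a.
  have cf : continuous f.
    move=> z; exact: (continuousB (@continuous_letter_value b z) (@continuous_letter_value a z)).
  set A := connected_component C x'.
  have cA : connected (f @` A).
    apply: connected_continuous_connected; first exact: component_connected.
    exact: continuous_subspaceT.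
  have Ay : A y' by rewrite /A e; exact: connected_component_refl.
  have Ax : A x' by exact: connected_component_refl.
  have [z Az fz] : (f @` A) 0.
    apply: ((connected_intervalP _).1 cA (f y') (f x')); [by exists y' | by exists x' |].
    by rewrite /f subr_le0 subr_ge0 !ltW.
  have /arrangement_complementP/(_ _ _ ab) := connected_component_sub Az.
  by move: fz; rewrite /f => /eqP; rewrite subr_eq0 eq_sym => ->.
pose g (t : R) : 'rV[R]_n.+1 := x + t *: (y - x).
have cg : continuous g.
  move=> t; apply: cvgD; [exact: cvg_cst | apply: cvgZr_tmp; exact: cvg_id].
apply: same_connected_component; exists (g @` `[0, 1]); first split.
- by exists 0; [rewrite /= in_itv /= lexx ler01 | rewrite /g scale0r addr0].
- move=> _ [t + <-]; rewrite /= in_itv /= => /andP[t0 t1].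
  apply/arrangement_complementP => a b ab; rewrite !letter_value_affine.
  have key p q r s : p < q -> r < s -> (1 - t) * p + t * r < (1 - t) * q + t * s.
    move=> pq rs; have [->|tn] := eqVneq t 0; first by lra.
    apply: ler_ltD; first by rewrite ler_wpM2l ?subr_ge0 // ltW.
    by rewrite ltr_pM2l // lt_def tn.
  have := congr1 (fun f : {ffun _ -> _} => f (a, b)) e; rewrite !ffunE /= ab /=.
  rewrite neq_lt; have [xab /esym yab|xba|xe] := ltgtP (letter_value x a) (letter_value x b).
  - by rewrite key.
  - move=> /esym/negbT; rewrite -leNgt le_eqVlt eq_sym (negPf (vy _ _ ab)) /= => yba.
    by apply/orP; right; apply: key.
  - by have := vx _ _ ab; rewrite xe eqxx.
- apply: connected_continuous_connected; first exact: segment_connected.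
  exact: continuous_subspaceT.
by exists 1; [rewrite /= in_itv /= lexx ler01 | rewrite /g scale1r addrC subrK].
Qed.

(** Regions correspond to the signatures of points, classes to the signatures of sketches, and these
    are the same signatures. *)
Lemma card_regions : (regions (D_arrangement R n.+1) #= `I_#|D_classes n.+1|)%card.
Proof.
have e := card_equivalence_partition (@D_equivalent_signature n.+1).
rewrite /D_classes e; apply: card_eq_trans (card_eq_seq (undup_uniq _)).
have <- : (@point_signature R n.+1) @` C =
   [set f | f \in undup [seq signature (word s) | s <- enum {: sketch n.+1}]].
  apply/seteqP; split=> [_ [x Cx <-]|f /=].
    have [w sw <-] := point_sketch Cx; have [s <-] := sketch_of sw.
    by rewrite /= mem_undup; apply/mapP; exists s; rewrite ?mem_enum.
  rewrite mem_undup => /mapP[s _ ->].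
  by have [x Cx <-] := sketch_point R (wordP s); exists x.
by apply: card_eq_images => x y Cx Cy; apply: same_region.
Qed.
End Regions.

Local Open Scope classical_set_scope.
Local Open Scope card_scope.

Theorem theorem5p2 (n : nat) (hn : (2 <= n)%N) :
  #|D_classes n| =
    (2 ^ (n - 1) * ((2 * n - 2)`! %/ (n - 1)`!) * (3 * n - 2))%N /\
  (forall R : realType,
    regions (D_arrangement R n) #=
      `I_(2 ^ (n - 1) * ((2 * n - 2)`! %/ (n - 1)`!) * (3 * n - 2))%N).
Proof.
case: n hn => // n _; rewrite -card_D_classes //; split=> // R.
exact: card_regions.
Qed.
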